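(* In terms of average weighted delay rate (AWDR), the instantaneous rate policy outperforms all renewal-type clearing policies whose cycle times have finite second moment, under a fixed clearing frequency. That is, if $\tau$ is a stopping time of $\{\mathcal{G}_t\}$ with $\mathbb{E}[\tau]>0$ and $\mathbb{E}[\tau^2]<\infty$, and $M>0$ is such that $\mathbb{E}[\tau_M]=\mathbb{E}[\tau]$, then $$\mathrm{AWDR}(\tau_M)\le\mathrm{AWDR}(\tau).$$
   Context: Let $n\ge 1$, let $B_1,\dots,B_n$ be independent standard Brownian motions (started at $0$), and let $N_i(t)=D_it+\sigma_iB_i(t)$ with $D_i>0$, $\sigma_i>0$ for $i=1,\dots,n$ (cumulative demand of items of type $i$). Let $\{\mathcal{G}_t\}$ be the natural filtration, $\mathcal{G}_t$ being generated by $\{N_1(s),\dots,N_n(s):s\in[0,t]\}$, and let $\omega_i>0$ be the waiting cost per unit of type $i$ per unit time. A renewal-type clearing policy is given by its clearing cycle, a stopping time $\tau$ of $\{\mathcal{G}_t\}$ with $0<\mathbb{E}[\tau]<\infty$; its average weighted delay rate is $$\mathrm{AWDR}(\tau)=\frac{\mathbb{E}\left[\sum_{i=1}^n\int_0^\tau\omega_iN_i(u)\,du\right]}{\mathbb{E}[\tau]}.$$ The instantaneous rate policy (IRP) with parameter $M>0$ has clearing cycle $\tau_M=\inf\{t>0:\sum_{i=1}^n\omega_iN_i(t)\ge M\}$. Policies have the same clearing frequency when their expected cycle lengths $\mathbb{E}[\tau]$ are equal. *)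

(* Defs.v *)
(* MathComp / MathComp-Analysis *)
From HB Require Import structures.
From mathcomp Require Import all_boot all_order all_algebra.
From mathcomp Require Import all_classical all_reals all_analysis.

Set Implicit Arguments.
Unset Strict Implicit.
Unset Printing Implicit Defensive.

Import Order.TTheory GRing.Theory Num.Theory.
Import numFieldNormedType.Exports.

Local Open Scope classical_set_scope.
Local Open Scope ring_scope.

Section Probability.
Context (d : measure_display) (T : measurableType d) (R : realType).
Variable P : probability T R.

Definition sigma_generated (I : Type) (X : I -> T -> R) (J : set I) :
    set (set T) :=
  <<s \bigcup_(j in J) preimage_set_system setT (X j) measurable >>.

Definition independent (F G : set (set T)) : Prop :=
  forall A C : set T, F A -> G C -> P (A `&` C) = (P A * P C)%E.

Definition mutually_independent (I : finType) (F : I -> set (set T)) : Prop :=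
  forall (J : {set I}) (A : I -> set T),
    (forall i, i \in J -> F i (A i)) ->
    P (\bigcap_(i in [set` J]) A i) = (\prod_(i in J) P (A i))%E.

(* Processes are indexed by [R], but only their values at times [0 <= t] are
   ever constrained or used. The second parameter of [normal_prob] is the
   standard deviation. *)
Record standard_brownian_motion (B : R -> {RV P >-> R}) : Prop := {
  sbm_start : forall w : T, B 0 w = 0;
  sbm_continuous : forall w : T,
    {within `[0, +oo[, continuous (fun t : R => B t w)};
  sbm_independent_increments : forall s t : R, 0 <= s -> s < t ->
    independent (sigma_generated B [set u | 0 <= u <= s])
      (sigma_generated (fun (_ : unit) (w : T) => B t w - B s w) setT);
  sbm_gaussian_increments : forall s t : R, 0 <= s -> s < t ->
    forall A : set R, measurable A ->
      P ((fun w : T => B t w - B s w) @^-1` A) =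
      normal_prob 0 (Num.sqrt (t - s)) A
}.

Definition independent_processes (I : finType) (B : I -> R -> {RV P >-> R}) :
    Prop :=
  mutually_independent (fun i => sigma_generated (B i) [set u | 0 <= u]).

Definition natural_filtration (I : Type) (N : I -> R -> T -> R) (t : R) :
    set (set T) :=
  sigma_generated (fun p : I * R => N p.1 p.2) [set p | 0 <= p.2 <= t].

Definition stopping_time (G : R -> set (set T)) (tau : T -> \bar R) : Prop :=
  (forall w : T, (0 <= tau w)%E) /\
  (forall t : R, 0 <= t -> G t [set w | (tau w <= t%:E)%E]).

Definition demand (I : Type) (D sigma : I -> R) (B : I -> R -> {RV P >-> R})
    (i : I) (t : R) (w : T) : R :=
  D i * t + sigma i * B i t w.

Definition AWDR (I : finType) (omega : I -> R) (N : I -> R -> T -> R)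
    (tau : T -> \bar R) : \bar R :=
  ((\int[P]_w \sum_(i : I)
      \int[lebesgue_measure]_(u in [set u : R | (0 <= u)%R /\ u%:E <= tau w])
        (omega i * N i u w)%:E)
   / \int[P]_w tau w)%E.

(* [+oo] when the level [M] is never reached. *)
Definition irp_cycle (I : finType) (omega : I -> R) (N : I -> R -> T -> R)
    (M : R) (w : T) : \bar R :=
  ereal_inf (EFin @` [set t : R | 0 < t /\ M <= \sum_(i : I) omega i * N i t w]).

End Probability.

(* Main.v *)
Require Import Defs.
From HB Require Import structures.
From mathcomp Require Import all_boot all_order all_algebra.
From mathcomp Require Import all_classical all_reals all_analysis.
From mathcomp Require Import measurable_realfun ring lra.

Set Implicit Arguments.
Unset Strict Implicit.
Unset Printing Implicit Defensive.

Import Order.TTheory GRing.Theory Num.Theory.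
Import numFieldNormedType.Exports.

Local Open Scope classical_set_scope.
Local Open Scope ring_scope.

(** Write [S t = b * t + X t] for the weighted cumulative demand, [X] being a
    Brownian motion with bracket [v * t], and put [c = M - v / (2 * b)]. The process
    [(S t - M)^2 / (2 * b) - int_0^t (S u - c) du] is a martingale, so a stopping
    time [tau] with finite second moment satisfies
    [E (int_0^tau S) - c * E tau = (E (S tau - M)^2 - M^2) / (2 * b)].
    The right-hand side is at least [- M^2 / (2 * b)], with equality when
    [S tau = M], which is how the instantaneous rate policy stops.

    Neither stochastic integrals nor maximal inequalities are needed. For
    [tau <= L], conditioning inside the time integral gives
    [E (int_0^tau X) = E (tau * X L)], and the identity becomes a comparison of
    [E (X L + b * tau - M)^2] with [v * E (L - tau)]. The lower bound is
    Pythagoras for [tau] rounded up to a grid; for the hitting time of [M] the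
    upper bound follows from Fatou's lemma along the grids, which also yields
    its finite second moment. The passage from capped to unbounded times is by
    dominated convergence. *)

(** * Square-integrable random variables *)

(** Capped times stay below [K] and are compared with the deterministic time [L = K + 1]. Since
    [X L - X sigma] is orthogonal to the past with conditional variance [v * (L - sigma)], replacing
    [X sigma] by [X L] and subtracting that variance leaves expectations unchanged; the lower bound
    thus never evaluates [X] at a random time off a grid. The natural filtration need not be
    right-continuous, so times are rounded strictly upwards, which only asks for the events
    [sigma < t].

    The obstacle is an asymmetry: [tau] comes with a second moment, the hitting time only with a
    finite mean. The estimates at grid times are therefore linear in [E sigma] and uniform in the
    cap. Moreover a capped hitting time has not stopped on the line when the cap is active; the
    paths with [K <= tau] need a separate tail estimate, whose bound disappears as [K] grows.

    The drift integrates to [b * tau ^ 2 / 2], so [2 * b] times the expected cost is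
    [2 * b * E area + b ^ 2 * E tau ^ 2]. All other terms of the two bounds depend only on [M], [v],
    [b] and the common mean, and cancel. *)

Section square_integrable.
Context (d : measure_display) (T : measurableType d) (R : realType).
Variable P : probability T R.

Definition square_integrable (f : T -> R) : Prop :=
  measurable_fun setT f /\ P.-integrable setT (EFin \o (fun w => f w ^+ 2)).

Lemma le_integrable_real (f g : T -> R) : measurable_fun setT f ->
  (forall w, `|f w| <= g w) -> P.-integrable setT (EFin \o g) ->
  P.-integrable setT (EFin \o f).
Proof.
move=> mf fg ig; apply: le_integrable ig => //; first exact/measurable_EFinP.
by move=> w _ /=; rewrite lee_fin; apply: (le_trans (fg w)); exact: ler_norm.
Qed.

Lemma integrable_realD (f g : T -> R) :
  P.-integrable setT (EFin \o f) -> P.-integrable setT (EFin \o g) ->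
  P.-integrable setT (EFin \o (fun w => f w + g w)).
Proof.
by move=> fi gi; apply: eq_integrable (integrableD _ fi gi) => //= w _.
Qed.

Lemma integrable_realB (f g : T -> R) :
  P.-integrable setT (EFin \o f) -> P.-integrable setT (EFin \o g) ->
  P.-integrable setT (EFin \o (fun w => f w - g w)).
Proof.
by move=> fi gi; apply: eq_integrable (integrableB _ fi gi) => //= w _.
Qed.

Lemma integrable_realZ (k : R) (f : T -> R) :
  P.-integrable setT (EFin \o f) ->
  P.-integrable setT (EFin \o (fun w => k * f w)).
Proof.
by move=> fi; apply: eq_integrable (integrableZl _ k fi) => //= w _.
Qed.

Lemma integrable_real_cst (k : R) : P.-integrable setT (EFin \o (fun=> k)).
Proof. exact: (@finite_measure_integrable_cst _ _ _ P setT k measurableT). Qed.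

Lemma integrable_real_measurable (f : T -> R) :
  P.-integrable setT (EFin \o f) -> measurable_fun setT f.
Proof. by move=> /measurable_int /measurable_EFinP. Qed.

Lemma square_integrableM (f g : T -> R) :
  square_integrable f -> square_integrable g ->
  P.-integrable setT (EFin \o (fun w => f w * g w)).
Proof.
move=> [mf fi] [mg gi].
apply: (@le_integrable_real _ (fun w => f w ^+ 2 + g w ^+ 2)).
- exact: measurable_funM.
- move=> w; rewrite normrM -[f w ^+ 2]real_normK ?num_real//.
  rewrite -[g w ^+ 2]real_normK ?num_real//.
  have := sqr_ge0 (`|f w| - `|g w|); have := normr_ge0 (f w).
  by have := normr_ge0 (g w); nra.
- exact: integrable_realD.
Qed.

Lemma square_integrable_cst (k : R) : square_integrable (fun=> k).
Proof. by split=> //; exact: integrable_real_cst. Qed.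

Lemma square_integrable_integrable (f : T -> R) :
  square_integrable f -> P.-integrable setT (EFin \o f).
Proof.
move=> fs; apply: eq_integrable (square_integrableM fs (square_integrable_cst 1)) => //.
by move=> w _ /=; rewrite mulr1.
Qed.

Lemma square_integrableD (f g : T -> R) :
  square_integrable f -> square_integrable g ->
  square_integrable (fun w => f w + g w).
Proof.
move=> fs gs; split; first by apply: measurable_funD; [case: fs|case: gs].
have := integrable_realD (integrable_realD fs.2 gs.2)
  (integrable_realZ 2 (square_integrableM fs gs)).
by apply: eq_integrable => //= w _; congr EFin; ring.
Qed.

Lemma square_integrableZ (k : R) (f : T -> R) :
  square_integrable f -> square_integrable (fun w => k * f w).
Proof.
move=> fs; split; first by apply: measurable_funM => //; case: fs.
have := integrable_realZ (k ^+ 2) fs.2.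
by apply: eq_integrable => //= w _; congr EFin; ring.
Qed.

Lemma square_integrableB (f g : T -> R) :
  square_integrable f -> square_integrable g ->
  square_integrable (fun w => f w - g w).
Proof.
move=> fs gs; have := square_integrableD fs (square_integrableZ (-1) gs).
by congr square_integrable; apply/funext => w; ring.
Qed.

Lemma square_integrable_sum (I : Type) (s : seq I) (f : I -> T -> R) :
  (forall i, square_integrable (f i)) ->
  square_integrable (fun w => \sum_(i <- s) f i w).
Proof.
move=> fs; elim: s => [|i s ih].
  by under eq_fun do rewrite big_nil; exact: square_integrable_cst.
by under eq_fun do rewrite big_cons; exact: square_integrableD.
Qed.

Lemma le_square_integrable (f g : T -> R) : measurable_fun setT f ->
  (forall w, `|f w| <= `|g w|) -> square_integrable g -> square_integrable f.
Proof.
move=> mf fg gs; split=> //; apply: le_integrable_real gs.2.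
  exact: measurable_funX.
move=> w; rewrite normrX -[g w ^+ 2]real_normK ?num_real//.
by rewrite lerXn2r ?nnegrE.
Qed.

Lemma square_integrable_indic (A : set T) (f : T -> R) : measurable A ->
  square_integrable f -> square_integrable (fun w => \1_A w * f w).
Proof.
move=> mA fs; apply: (le_square_integrable _ _ fs); last first.
  move=> w; rewrite normrM ler_piMl// ger0_norm ?indicE// ?lern1 ?leq_b1//.
by apply: measurable_funM; [exact: measurable_indic|case: fs].
Qed.

Lemma integrable_real_indic (A : set T) (f : T -> R) : measurable A ->
  P.-integrable setT (EFin \o f) ->
  P.-integrable setT (EFin \o (fun w => \1_A w * f w)).
Proof.
move=> mA fi; apply: (@le_integrable_real _ (fun w => `|f w|)).
- apply: measurable_funM; first exact: measurable_indic.
  exact: integrable_real_measurable.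
- move=> w /=; rewrite normrM ler_piMl// ger0_norm ?indicE// ?lern1 ?leq_b1//.
- exact: integrable_norm.
Qed.

Lemma Rintegral_realZ (k : R) (f : T -> R) : P.-integrable setT (EFin \o f) ->
  \int[P]_w (k * f w) = k * \int[P]_w f w.
Proof. exact: RintegralZl. Qed.

Lemma Rintegral_real_cst (k : R) : \int[P]_w k = k.
Proof.
rewrite Rintegral_cst// -[RHS]mulr1; congr (_ * _).
exact: (congr1 fine (probability_setT P)).
Qed.

Lemma Rintegral_real_sum (I : Type) (s : seq I) (f : I -> T -> R) :
  (forall i, P.-integrable setT (EFin \o f i)) ->
  \int[P]_w (\sum_(i <- s) f i w) = \sum_(i <- s) \int[P]_w f i w.
Proof.
move=> fi; elim: s => [|i s ih].
  rewrite big_nil; under eq_Rintegral do rewrite big_nil.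
  exact: Rintegral_real_cst.
rewrite big_cons -ih; under eq_Rintegral do rewrite big_cons.
rewrite RintegralD//.
have := integrable_sum measurableT s (fun i (_ : true) => fi i).
by apply: eq_integrable => //= w _; rewrite sumEFin.
Qed.

Lemma Rintegral_EFin (f : T -> R) : P.-integrable setT (EFin \o f) ->
  (\int[P]_w (f w)%:E)%E = (\int[P]_w f w)%:E.
Proof.
by move=> fi; rewrite fineK//; exact: integrable_fin_num.
Qed.

End square_integrable.

(** * Moments of Gaussian increments *)

Section gaussian_moments.
Context (R : realType).
Local Notation mu := (@lebesgue_measure R).

Definition gaussian_moment2 (s : R) : \bar R :=
  (\int[mu]_x (x ^+ 2 * normal_pdf 0 s x)%:E)%E.

Lemma gaussian_moment2_ge0 (s : R) : (0 <= gaussian_moment2 s)%E.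
Proof.
by apply: integral_ge0 => x _; rewrite lee_fin mulr_ge0 ?sqr_ge0 ?normal_pdf_ge0.
Qed.

(** Change of variables is available through the Radon-Nikodym derivative of [normal_prob]; it
    agrees almost everywhere with the density because both have the same integral over every
    measurable set. *)
Lemma ge0_integral_normal_prob (m s : R) (f : R -> \bar R) :
  measurable_fun setT f -> (forall x, (0 <= f x)%E) ->
  (\int[normal_prob m s]_x f x =
   \int[mu]_x (f x * (normal_pdf m s x)%:E))%E.
Proof.
move=> mf f0; have dom := @normal_prob_dominates R m s.
rewrite -(Radon_Nikodym_SigmaFinite.change_of_variables dom)//.
have mpdf : measurable_fun setT (fun x => (normal_pdf m s x)%:E).
  by apply/measurable_EFinP; exact: measurable_normal_pdf.
have iRN := Radon_Nikodym_SigmaFinite.f_integrable dom.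
apply: ae_eq_integral => //.
- by apply: emeasurable_funM => //; exact: measurable_int iRN.
- exact: emeasurable_funM.
- apply: ae_eqe_mul2l; apply: integral_ae_eq => //= E _ mE.
  by rewrite -Radon_Nikodym_SigmaFinite.f_integral.
Qed.

Lemma normal_peak_scale (s : R) : 0 < s -> s * normal_peak s = normal_peak 1.
Proof.
move=> s0; rewrite /normal_peak expr1n mul1r -mulrnAr sqrtrM ?sqr_ge0//.
rewrite sqrtr_sqr gtr0_norm// invfM mulrA divff ?gt_eqF// mul1r.
by congr (Num.sqrt _)^-1; rewrite mulrnAr mul1r.
Qed.

(** Substitution [x = s * y]: the Jacobian [s] is absorbed by the peak ([normal_peak_scale]), and
    the factor [s ^ 2] comes from the square. With [s = sqrt (t - u)] this is the linear growth of
    the Brownian bracket. *)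
Lemma gaussian_moment2_scale (s : R) : 0 < s ->
  gaussian_moment2 s = ((s ^+ 2)%:E * gaussian_moment2 1)%E.
Proof.
move=> s0; pose F (x : R^o) : R^o := s * x.
have F'E : F^`()%classic = cst s.
  apply/funext => x; rewrite /F derive1E deriveM// derive_cst scaler0 addr0.
  by rewrite derive_id scaler1.
have cG : continuous (fun x : R => x ^+ 2 * normal_pdf 0 s x).
  move=> x; apply: cvgM; first exact: exprn_continuous.
  by apply: continuous_normal_pdf; rewrite gt_eqF.
rewrite /gaussian_moment2 -ge0_integralZl//; last 3 first.
- apply/measurable_EFinP/measurable_funM; first exact: exprn_measurable.
  exact: measurable_normal_pdf.
- by move=> x _; rewrite lee_fin mulr_ge0 ?sqr_ge0 ?normal_pdf_ge0.
- by rewrite lee_fin sqr_ge0.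
rewrite (@increasing_ge0_integration_by_substitutionT _ F)//.
- apply: eq_integral => x _; rewrite F'E -EFinM/=; congr EFin.
  rewrite -[LHS]/((s * x) ^+ 2 * normal_pdf 0 s (s * x) * s).
  rewrite !normal_pdfE ?gt_eqF// -(normal_peak_scale s0) /normal_fun.
  rewrite !subr0 expr1n exprMn.
  have -> : - (s ^+ 2 * x ^+ 2) / (s ^+ 2 *+ 2) = - x ^+ 2 / (1 *+ 2).
    by field; rewrite gt_eqF.
  by set e := expR _; ring.
- by move=> x y xy; rewrite /F ltr_pM2l.
- by rewrite F'E => ?; exact: cvg_cst.
- by rewrite F'E; exact: is_cvg_cst.
- by rewrite F'E; exact: is_cvg_cst.
- by apply/gt0_cvgMrNy => //; exact: cvg_id.
- by apply/gt0_cvgMry => //; exact: cvg_id.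
- by move=> x; rewrite mulr_ge0 ?sqr_ge0 ?normal_pdf_ge0.
Qed.

(* [y <= exp y] at [y = x^2/4] turns [x^2] into a wider Gaussian. *)
Lemma gaussian_moment2_lty : (gaussian_moment2 1 < +oo)%E.
Proof.
pose s : R := Num.sqrt 2.
have s0 : 0 < s by rewrite sqrtr_gt0.
have s2 : s ^+ 2 = 2 by rewrite sqr_sqrtr.
pose C : R := 4 * normal_peak 1 / normal_peak s.
have C0 : 0 <= C by rewrite divr_ge0 ?mulr_ge0 ?normal_peak_ge0.
apply: (@le_lt_trans _ _ (\int[mu]_x (C%:E * (normal_pdf 0 s x)%:E))%E).
  apply: ge0_le_integral => //.
  - by move=> x _; rewrite lee_fin mulr_ge0 ?sqr_ge0 ?normal_pdf_ge0.
  - apply/measurable_EFinP/measurable_funM; first exact: exprn_measurable.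
    exact: measurable_normal_pdf.
  - apply/measurable_EFinP/measurable_funM => //; exact: measurable_normal_pdf.
  - move=> x _; rewrite lee_fin !normal_pdfE ?gt_eqF// /normal_fun !subr0.
    rewrite s2 expr1n /C; set p := normal_peak 1.
    have q0 : normal_peak s != 0 by rewrite gt_eqF// normal_peak_gt0// gt_eqF.
    have -> : - x ^+ 2 / (1 *+ 2) = - x ^+ 2 / (2 *+ 2) + - x ^+ 2 / (2 *+ 2).
      by field.
    rewrite expRD; set e := expR _.
    have e0 : 0 < e by exact: expR_gt0.
    have p0 : 0 <= p by exact: normal_peak_ge0.
    have -> : 4 * p / normal_peak s * (normal_peak s * e) = p * e * 4 by field.
    have -> : x ^+ 2 * (p * (e * e)) = p * e * (x ^+ 2 * e) by ring.
    apply: ler_wpM2l; first by rewrite mulr_ge0// ltW.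
    have := expR_ge1Dx (x ^+ 2 / 4).
    have -> : expR (x ^+ 2 / 4) = e^-1 by rewrite -expRN; congr expR; field.
    move=> /(ler_wpM2r (ltW e0)); rewrite mulVf ?gt_eqF// => h.
    by lra.
rewrite ge0_integralZl//.
- by rewrite integral_normal_pdf mule1 ltry.
- by apply/measurable_EFinP; exact: measurable_normal_pdf.
- by move=> x _; rewrite lee_fin normal_pdf_ge0.
Qed.

End gaussian_moments.

Section gaussian_law.
Context (R : realType).
Local Notation mu := (@lebesgue_measure R).

(** The centred density is even and Lebesgue measure is invariant under reflection. *)
Lemma normal_probN (s : R) (A : set R) : s != 0 -> measurable A ->
  normal_prob 0 s (-%R @^-1` A) = normal_prob 0 s A.
Proof.
move=> s0 mA; rewrite /normal_prob.
have mN : measurable_fun [set: R] (-%R : R -> measurableTypeR R).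
  exact: oppr_measurable.
have mpdf : measurable_fun A (fun x => (normal_pdf 0 s x)%:E).
  by apply/measurable_EFinP/measurable_funTS; exact: measurable_normal_pdf.
transitivity (\int[pushforward mu (-%R : _ -> measurableTypeR R)]_(x in A)
    (normal_pdf 0 s x)%:E)%E.
  rewrite ge0_integral_pushforward//; last first.
    by move=> x _; rewrite lee_fin normal_pdf_ge0.
  apply: eq_integral => x _ /=; rewrite !normal_pdfE//.
  by rewrite /normal_fun !subr0 sqrrN.
apply: eq_measure_integral => //= B mB BA; exact: lebesgue_measureN.
Qed.

Context (d : measure_display) (T : measurableType d) (P : probability T R).
Variables (W : T -> R) (s : R).
Hypothesis mW : measurable_fun setT W.
Hypothesis s_gt0 : 0 < s.
Hypothesis W_law :
  forall A, measurable A -> P (W @^-1` A) = normal_prob 0 s A.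

Lemma integral_gaussian_sqr :
  (\int[P]_w (W w ^+ 2)%:E = ((s ^+ 2)%:E * gaussian_moment2 (1 : R)))%E.
Proof.
have msq : measurable_fun setT (fun x : R => (x ^+ 2)%:E).
  by apply/measurable_EFinP; exact: exprn_measurable.
rewrite -gaussian_moment2_scale// /gaussian_moment2.
transitivity (\int[normal_prob 0 s]_x (x ^+ 2)%:E)%E; last first.
  rewrite ge0_integral_normal_prob// => x; by rewrite lee_fin sqr_ge0.
transitivity (\int[pushforward P (W : T -> measurableTypeR R)]_x (x ^+ 2)%:E)%E.
  rewrite ge0_integral_pushforward// => x _; by rewrite lee_fin sqr_ge0.
by apply: eq_measure_integral => //= A mA _; exact: W_law.
Qed.

(* The value 1 is never needed: only finiteness and scaling are. *)
Definition gaussian_variance : R := fine (gaussian_moment2 (1 : R)).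

Lemma gaussian_moment2E : gaussian_moment2 (1 : R) = gaussian_variance%:E.
Proof.
by rewrite fineK// ge0_fin_numE ?gaussian_moment2_lty// gaussian_moment2_ge0.
Qed.

Lemma square_integrable_gaussian : square_integrable P W.
Proof.
split=> //; apply/integrableP; split.
  by apply/measurable_EFinP; exact: measurable_funX.
under eq_integral do rewrite /= ger0_norm ?sqr_ge0//.
by rewrite integral_gaussian_sqr gaussian_moment2E -EFinM ltry.
Qed.

Lemma Rintegral_gaussian_sqr :
  \int[P]_w (W w ^+ 2) = s ^+ 2 * gaussian_variance.
Proof. by rewrite /Rintegral integral_gaussian_sqr gaussian_moment2E. Qed.

(** [W] and [- W] have the same law by [normal_probN], so the finite mean equals its opposite. *)
Lemma Rintegral_gaussian : \int[P]_w W w = 0.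
Proof.
have iW := square_integrable_integrable square_integrable_gaussian.
have iN : P.-integrable setT (EFin \o (fun w => - W w)).
  by apply: eq_integrable (integrable_realZ (-1) iW) => //= w _; rewrite mulN1r.
have mN : measurable_fun [set: T] ((fun w => - W w) : T -> measurableTypeR R).
  exact: integrable_real_measurable iN.
suff h : (\int[P]_w W w = \int[P]_w (- W w)).
  have h2 : \int[P]_w (- W w) = - \int[P]_w W w.
    rewrite -mulN1r -Rintegral_realZ//.
    by apply: eq_Rintegral => w _; rewrite mulN1r.
  by lra.
rewrite /Rintegral; congr fine.
transitivity (\int[pushforward P (W : T -> measurableTypeR R)]_x x%:E)%E.
  by rewrite integral_pushforward.
rewrite -[RHS](@integral_pushforward _ _ _ _ _ _ mN P setT EFin)//.
apply: eq_measure_integral => A mA _ /=; rewrite /pushforward.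
rewrite W_law// -(@normal_probN _ A) ?gt_eqF// -W_law//.
by rewrite -[X in measurable X]setTI; exact: oppr_measurable.
Qed.

End gaussian_law.

(** * Independence *)

Section independent_product.
Context (d : measure_display) (T : measurableType d) (R : realType).
Variable P : probability T R.

(** The joint law of [(U, W)] agrees with the product of the marginals on rectangles, hence
    everywhere; Fubini then factors the integral of [x * y]. *)
Lemma Rintegral_independentM (U W : {mfun T >-> R}) :
  P.-integrable setT (EFin \o U) -> P.-integrable setT (EFin \o W) ->
  P.-integrable setT (EFin \o (fun w => U w * W w)) ->
  (forall A C : set R, measurable A -> measurable C ->
    P (U @^-1` A `&` W @^-1` C) = (P (U @^-1` A) * P (W @^-1` C))%E) ->
  \int[P]_w (U w * W w) = \int[P]_w U w * \int[P]_w W w.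
Proof.
move=> iU iW iUW UW.
have mUW : measurable_fun [set: T] (fun w => (U w, W w)).
  exact: measurable_fun_pair.
pose m := pushforward P (fun w => (U w, W w)).
pose mU := distribution P U; pose mW := distribution P W.
have prodE A : measurable A -> (mU \x mW)%E A = m A.
  by move=> mA; apply: product_measure_unique => // B C mB mC; exact: UW.
pose f (z : R * R) : \bar R := (z.1 * z.2)%:E.
have mf : measurable_fun setT f.
  by apply/measurable_EFinP/measurable_funM.
have if' : (mU \x mW)%E.-integrable setT f.
  apply/integrableP; split=> //.
  rewrite (eq_measure_integral m) => [|A mA _]; last exact: prodE.
  rewrite ge0_integral_pushforward//; last exact: measurableT_comp.
  by have /integrableP[_] := iUW.
rewrite /Rintegral.
have -> : (\int[P]_w (U w * W w)%:E = \int[(mU \x mW)%E]_z f z)%E.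
  rewrite (eq_measure_integral m) => [|A mA _]; last exact: prodE.
  by rewrite integral_pushforward.
rewrite -integral12_prod_meas1// /fubini_F /f /=.
have iWl : mW.-integrable setT (@EFin R) by exact: integrable_pushforward.
under eq_integral.
  move=> x _; under eq_integral do rewrite EFinM.
  rewrite integralZl// integral_distribution// Rintegral_EFin//.
  over.
rewrite integralZr//; last exact: integrable_pushforward.
by rewrite integral_distribution// !Rintegral_EFin.
Qed.

Lemma Rintegral_independentM_fun (U W : T -> R) :
  P.-integrable setT (EFin \o U) -> P.-integrable setT (EFin \o W) ->
  P.-integrable setT (EFin \o (fun w => U w * W w)) ->
  (forall A C : set R, measurable A -> measurable C ->
    P (U @^-1` A `&` W @^-1` C) = (P (U @^-1` A) * P (W @^-1` C))%E) ->
  \int[P]_w (U w * W w) = \int[P]_w U w * \int[P]_w W w.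
Proof.
move=> iU iW.
pose mU := isMeasurableFun.Build _ _ _ _ U (integrable_real_measurable iU).
pose mW := isMeasurableFun.Build _ _ _ _ W (integrable_real_measurable iW).
pose U' : {mfun T >-> R} := HB.pack U mU.
pose W' : {mfun T >-> R} := HB.pack W mW.
exact: (@Rintegral_independentM U' W').
Qed.

End independent_product.

(** * Measurability with respect to sub-sigma-algebras, and independence from a pi-system *)

Section sub_sigma_algebras.
Context (d : measure_display) (T : measurableType d) (R : realType).

(** Retyping the domain makes the library's closure properties of measurable functions directly
    applicable. [G] may be a mere generating class, such as [past_box] below. *)
Definition measurable_wrt (G : set (set T)) (U : T -> R) : Prop :=
  measurable_fun setT (U : g_sigma_algebraType G -> R).

Lemma measurable_wrt_preimage (G : set (set T)) (U : T -> R) (A : set R) :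
  measurable_wrt G U -> measurable A -> <<s G >> (U @^-1` A).
Proof. by move=> mU mA; have := mU measurableT A mA; rewrite setTI. Qed.

Lemma measurable_wrtP (G : set (set T)) (U : T -> R) :
  (forall A, measurable A -> <<s G >> (U @^-1` A)) -> measurable_wrt G U.
Proof. by move=> h _ A mA; rewrite setTI; exact: h. Qed.

Lemma measurable_wrt_sub (G G' : set (set T)) (U : T -> R) :
  <<s G >> `<=` <<s G' >> -> measurable_wrt G U -> measurable_wrt G' U.
Proof.
move=> GG' mU; apply: measurable_wrtP => A mA; apply: GG'.
exact: measurable_wrt_preimage.
Qed.

Lemma measurable_wrt_measurable (G : set (set T)) (U : T -> R) :
  G `<=` measurable -> measurable_wrt G U -> measurable_fun setT U.
Proof.
move=> Gm mU _ A mA; rewrite setTI.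
apply: (smallest_sub _ Gm (measurable_wrt_preimage mU mA)).
exact: sigma_algebra_measurable.
Qed.

Lemma sigma_generated_gen (I : Type) (X : I -> T -> R) (J : set I) (t : I)
    (A : set R) : J t -> measurable A -> sigma_generated X J (X t @^-1` A).
Proof.
move=> Jt mA; apply: sub_sigma_algebra; exists t => //.
by exists A => //; rewrite setTI.
Qed.

Lemma sigma_generated_sub (I : Type) (X : I -> T -> R) (J : set I)
    (G : set (set T)) : sigma_algebra setT G ->
  (forall t A, J t -> measurable A -> G (X t @^-1` A)) ->
  sigma_generated X J `<=` G.
Proof.
move=> sG h; apply: smallest_sub => // _ [t Jt [A mA <-]].
by rewrite setTI; exact: h.
Qed.

Lemma sigma_generated_sigma_algebra (I : Type) (X : I -> T -> R) (J : set I) :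
  sigma_algebra setT (sigma_generated X J).
Proof. exact: smallest_sigma_algebra. Qed.

Lemma sigma_algebraI (G : set (set T)) (A A' : set T) :
  sigma_algebra setT G -> G A -> G A' -> G (A `&` A').
Proof.
move=> sG GA GA'.
have := @measurableI _ (g_sigma_algebraType G) A A'.
by rewrite measurable_g_measurableTypeE//; apply.
Qed.

Lemma sigma_algebra_setT (G : set (set T)) : sigma_algebra setT G -> G setT.
Proof. by move=> [G0 GC _]; have := GC _ G0; rewrite setD0. Qed.

End sub_sigma_algebras.

Section independent_pi_system.
Context (d : measure_display) (T : measurableType d) (R : realType).
Variable P : probability T R.

(** Dynkin's argument: [A |-> P (A & C)] and [A |-> P A * P C] are finite measures that agree on a
    generating pi-system. That [setT] belongs to [G] supplies the exhausting sequence for uniqueness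
    of measures. *)
Lemma independent_generated (G : set (set T)) (C : set T) :
  G `<=` measurable -> setI_closed G -> G setT -> measurable C ->
  (forall A, G A -> P (A `&` C) = (P A * P C)%E) ->
  forall A, <<s G >> A -> P (A `&` C) = (P A * P C)%E.
Proof.
move=> Gm GI GT mC GC A sA.
have PC0 : 0 <= fine (P C) by rewrite fine_ge0.
have PCE : (fine (P C))%:E = P C by rewrite fineK// fin_num_measure.
pose m1 := mrestr P mC; pose m2 := mscale (NngNum PC0) P.
have m2E B : m2 B = (P B * P C)%E by rewrite /m2 /mscale/= PCE muleC.
rewrite -m2E -[LHS]/(m1 A).
apply: (@g_sigma_algebra_measure_unique _ _ _ G Gm (fun=> setT)) => //.
- by rewrite bigcup_const.
- by move=> B GB; rewrite [RHS]m2E -GC.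
- move=> _; rewrite /= /mrestr setTI ltey_eq; apply/orP; left.
  exact: fin_num_measure.
Qed.

End independent_pi_system.

(** * Vectors of independent Brownian motions *)

Section brownian_vector.
Context (R : realType) (d : measure_display) (T : measurableType d).
Variables (P : probability T R) (n : nat) (B : 'I_n -> R -> {RV P >-> R}).
Hypothesis B_brownian : forall i : 'I_n, standard_brownian_motion (B i).
Hypothesis B_indep : independent_processes B.

(* Boxes of events seen by [B j] up to time [s] and by the other components at
   any time; they are independent of the increments of [B j] after [s]. *)
Definition past_box (j : 'I_n) (s : R) : set (set T) :=
  [set A | exists2 E : 'I_n -> set T,
    (forall k, sigma_generated (B k)
      [set u | 0 <= u /\ (k = j -> u <= s)] (E k)) &
    A = \bigcap_(k in [set: 'I_n]) E k].

Lemma sigma_generated_measurable (k : 'I_n) (J : set R) :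
  sigma_generated (B k) J `<=` measurable.
Proof.
apply: sigma_generated_sub; first exact: sigma_algebra_measurable.
by move=> t A _ mA; rewrite -[X in measurable X]setTI; exact: measurable_funPT.
Qed.

Lemma past_box_measurable (j : 'I_n) (s : R) : past_box j s `<=` measurable.
Proof.
move=> _ [E HE ->]; apply: fin_bigcap_measurable => // k _.
exact: (sigma_generated_measurable (HE k)).
Qed.

Lemma past_boxI (j : 'I_n) (s : R) : setI_closed (past_box j s).
Proof.
move=> _ _ [E HE ->] [E' HE' ->]; exists (fun k => E k `&` E' k).
  move=> k.
  exact: (sigma_algebraI (sigma_generated_sigma_algebra _ _) (HE k) (HE' k)).
by rewrite bigcapI.
Qed.

Lemma past_boxT (j : 'I_n) (s : R) : past_box j s setT.
Proof.
exists (fun=> setT); last by rewrite bigcapT.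
move=> k; exact: (sigma_algebra_setT (sigma_generated_sigma_algebra _ _)).
Qed.

Lemma past_box_component (j k : 'I_n) (s u : R) : 0 <= u ->
  (k = j -> u <= s) -> measurable_wrt (past_box j s) (B k u).
Proof.
move=> u0 us; apply: measurable_wrtP => A mA; apply: sub_sigma_algebra.
exists (fun i => if i == k then B k u @^-1` A else setT).
  move=> i; case: eqP => [->|_]; first exact: sigma_generated_gen.
  exact: (sigma_algebra_setT (sigma_generated_sigma_algebra _ _)).
apply/seteqP; split => [w Aw i _|w /(_ k I)]; last by rewrite eqxx.
by case: eqP.
Qed.

Definition increment (j : 'I_n) (s t : R) (w : T) : R := B j t w - B j s w.

Lemma measurable_increment j s t : measurable_fun setT (increment j s t).
Proof. by apply: measurable_funB; exact: measurable_funPT. Qed.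

(** By [independent_generated] it suffices to treat boxes. There the increment event [D] is absorbed
    into the factor of [B j]: mutual independence of the components factors both the box and the
    modified box, and independence of the increments of [B j] splits [E j & D]. *)
Lemma past_box_increment_independent (j : 'I_n) (s t : R) (A : set T)
    (C : set R) : 0 <= s -> s < t -> <<s past_box j s >> A -> measurable C ->
  P (A `&` increment j s t @^-1` C) = (P A * P (increment j s t @^-1` C))%E.
Proof.
move=> s0 st sA mC; set D := _ @^-1` C.
have mD : measurable D.
  by rewrite -[X in measurable X]setTI; exact: measurable_increment.
apply: (independent_generated (G := past_box j s)) => //.
- exact: past_box_measurable.
- exact: past_boxI.
- exact: past_boxT.
move=> _ [E HE ->].
have EJ k : sigma_generated (B k) [set u | 0 <= u] (E k).
  by apply: (sub_sigma_algebra2 _ (HE k)); apply: bigcup_subset => u [].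
have DJ : sigma_generated (B j) [set u | 0 <= u] D.
  have mB u : 0 <= u ->
      measurable_wrt (sigma_generated (B j) [set u | 0 <= u]) (B j u).
    move=> u0; apply: measurable_wrtP => A' mA'; apply: sub_sigma_algebra.
    exact: sigma_generated_gen.
  have := measurable_wrt_preimage
    (measurable_funB (mB t (le_trans s0 (ltW st))) (mB s s0)) mC.
  by rewrite sigma_algebra_id//; exact: sigma_generated_sigma_algebra.
have PE (F : 'I_n -> set T) :
    (forall k, sigma_generated (B k) [set u | 0 <= u] (F k)) ->
    P (\bigcap_(k in [set: 'I_n]) F k) = (\prod_k P (F k))%E.
  move=> HF; have := @B_indep finset.setT F (fun i _ => HF i).
  have -> : [set` finset.setT] = [set: 'I_n].
    by apply/seteqP; split => // k _ /=; rewrite finset.in_setT.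
  by move=> ->; apply: eq_bigl => k; rewrite finset.in_setT.
pose F k := if k == j then E k `&` D else E k.
have -> : \bigcap_(k in [set: 'I_n]) E k `&` D = \bigcap_(k in [set: 'I_n]) F k.
  apply/seteqP; split => [w [Ew Dw] k _|w Fw].
    by rewrite /F; case: eqP => _; [split=> //; exact: Ew|exact: Ew].
  split=> [k _|]; last by have := Fw j I; rewrite /F eqxx => -[].
  by have := Fw k I; rewrite /F; case: eqP => // _ [].
rewrite !PE//; last first.
  move=> k; rewrite /F; case: eqP => [->|_//].
  exact: (sigma_algebraI (sigma_generated_sigma_algebra _ _) (EJ j) DJ).
rewrite (bigD1 j)//= [in RHS](bigD1 j)//= {1}/F eqxx.
have -> : P (E j `&` D) = (P (E j) * P D)%E.
  apply: (sbm_independent_increments (B_brownian j) s0 st).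
    apply: (sub_sigma_algebra2 _ (HE j)); apply: bigcup_subset => u [u0 us] /=.
    by rewrite u0 us.
  by apply: (@sigma_generated_gen _ _ _ _
    (fun (_ : unit) (w : T) => B j t w - B j s w) setT tt).
rewrite [in RHS]muleAC; congr (_ * _)%E.
by apply: eq_bigr => k /negbTE kj; rewrite /F kj.
Qed.

End brownian_vector.

(** * Conditional moments of increments of a linear combination of Brownian motions *)

Section brownian_increments.
Context (R : realType) (d : measure_display) (T : measurableType d).
Variables (P : probability T R) (n : nat) (B : 'I_n -> R -> {RV P >-> R}).
Hypothesis B_brownian : forall i : 'I_n, standard_brownian_motion (B i).
Hypothesis B_indep : independent_processes B.

Let kappa : R := gaussian_variance R.

Lemma increment_law (j : 'I_n) (s t : R) (A : set R) : 0 <= s -> s < t ->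
  measurable A ->
  P (increment B j s t @^-1` A) = normal_prob 0 (Num.sqrt (t - s)) A.
Proof. by move=> s0 st mA; exact: (sbm_gaussian_increments (B_brownian j)). Qed.

Lemma increment_square_integrable (j : 'I_n) (s t : R) : 0 <= s -> s < t ->
  square_integrable P (increment B j s t).
Proof.
move=> s0 st; apply: (@square_integrable_gaussian _ _ _ _ _ (Num.sqrt (t - s))).
- exact: measurable_increment.
- by rewrite sqrtr_gt0 subr_gt0.
- by move=> A mA; exact: increment_law.
Qed.

Lemma Rintegral_increment (j : 'I_n) (s t : R) : 0 <= s -> s < t ->
  \int[P]_w increment B j s t w = 0.
Proof.
move=> s0 st; apply: (@Rintegral_gaussian _ _ _ _ _ (Num.sqrt (t - s))).
- exact: measurable_increment.
- by rewrite sqrtr_gt0 subr_gt0.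
- by move=> A mA; exact: increment_law.
Qed.

Lemma Rintegral_increment_sqr (j : 'I_n) (s t : R) : 0 <= s -> s < t ->
  \int[P]_w (increment B j s t w ^+ 2) = (t - s) * kappa.
Proof.
move=> s0 st; rewrite -[t - s in RHS]sqr_sqrtr ?subr_ge0 ?ltW//.
apply: Rintegral_gaussian_sqr.
- exact: measurable_increment.
- by rewrite sqrtr_gt0 subr_gt0.
- by move=> A mA; exact: increment_law.
Qed.

Lemma past_increment0 (j : 'I_n) (s t : R) (U : T -> R) : 0 <= s -> s < t ->
  square_integrable P U -> measurable_wrt (past_box B j s) U ->
  \int[P]_w (U w * increment B j s t w) = 0.
Proof.
move=> s0 st Us mU; have Is := increment_square_integrable j s0 st.
rewrite Rintegral_independentM_fun.
- by rewrite Rintegral_increment// mulr0.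
- exact: square_integrable_integrable.
- exact: square_integrable_integrable.
- exact: square_integrableM.
- move=> A C mA mC; apply: past_box_increment_independent => //.
  exact: measurable_wrt_preimage.
Qed.

Lemma measurable_past (j : 'I_n) (s : R) (A : set T) :
  <<s past_box B j s >> A -> measurable A.
Proof.
apply: smallest_sub; first exact: sigma_algebra_measurable.
exact: past_box_measurable.
Qed.

Lemma past_increment_sqr (j : 'I_n) (s t : R) (A : set T) : 0 <= s -> s < t ->
  <<s past_box B j s >> A ->
  \int[P]_w (\1_A w * increment B j s t w ^+ 2) =
  (t - s) * kappa * \int[P]_w \1_A w.
Proof.
move=> s0 st sA; have Is := increment_square_integrable j s0 st.
have mA := measurable_past sA.
rewrite Rintegral_independentM_fun.
- by rewrite Rintegral_increment_sqr// mulrC.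
- exact: integrable_indic.
- exact: Is.2.
- exact: (integrable_real_indic mA Is.2).
- move=> A' C mA' mC.
  rewrite -[(fun w => _) @^-1` C]/(increment B j s t @^-1` ((fun x => x ^+ 2) @^-1` C)).
  apply: past_box_increment_independent => //.
    have mI : measurable_wrt (past_box B j s) (\1_A : T -> R).
      exact: (@measurable_indic _ (g_sigma_algebraType (past_box B j s))).
    exact: measurable_wrt_preimage.
  rewrite -[X in measurable X]setTI; exact: exprn_measurable.
Qed.

(** Boxes for [j] let the other components run at all times, so the increment of [B i] counts as
    past relative to [B j]; the claim is then [past_increment0] for [j]. *)
Lemma past_increment_cross (i j : 'I_n) (s t : R) (A : set T) : 0 <= s ->
  s < t -> i != j -> <<s past_box B j s >> A ->
  \int[P]_w (\1_A w * (increment B i s t w * increment B j s t w)) = 0.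
Proof.
move=> s0 st ij sA; have Is k := increment_square_integrable k s0 st.
have mA := measurable_past sA.
rewrite -[RHS](@past_increment0 j s t (fun w => \1_A w * increment B i s t w))//.
- by apply: eq_Rintegral => w _; rewrite mulrA.
- exact: square_integrable_indic.
- have ij' : i = j -> False by move/eqP; rewrite (negbTE ij).
  have mI : measurable_wrt (past_box B j s) (\1_A : T -> R).
    exact: (@measurable_indic _ (g_sigma_algebraType (past_box B j s))).
  have mB u : 0 <= u -> measurable_wrt (past_box B j s) (B i u).
    by move=> u0; apply: past_box_component => // /ij'.
  apply: (measurable_funM mI).
  exact: (measurable_funB (mB t (le_trans s0 (ltW st))) (mB s s0)).
Qed.

Variable a : 'I_n -> R.
Variable G : R -> set (set T).
Hypothesis G_past : forall j s, 0 <= s -> G s `<=` <<s past_box B j s >>.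

Definition combination (t : R) (w : T) : R := \sum_i a i * B i t w.

Let X := combination.

Let XB s t w : X t w - X s w = \sum_i a i * increment B i s t w.
Proof.
by rewrite /X /combination -sumrB; apply: eq_bigr => i _; rewrite -mulrBr.
Qed.

Lemma combination_increment_square_integrable s t : 0 <= s -> s <= t ->
  square_integrable P (fun w => X t w - X s w).
Proof.
move=> s0; rewrite le_eqVlt => /predU1P[->|st].
  under eq_fun do rewrite subrr; exact: square_integrable_cst.
under eq_fun do rewrite XB; apply: square_integrable_sum => i.
by apply: square_integrableZ; exact: increment_square_integrable.
Qed.

Lemma combination_martingale s t (U : T -> R) : 0 <= s -> s <= t ->
  square_integrable P U -> measurable_wrt (G s) U ->
  \int[P]_w (U w * (X t w - X s w)) = 0.
Proof.
move=> s0; rewrite le_eqVlt => /predU1P[-> Us mU|st Us mU].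
  by under eq_Rintegral do rewrite subrr mulr0; exact: Rintegral_real_cst.
have Is i := increment_square_integrable i s0 st.
under eq_Rintegral do rewrite XB mulr_sumr.
rewrite Rintegral_real_sum => [|i].
  apply: big1 => i _; under eq_Rintegral do rewrite mulrCA.
  rewrite Rintegral_realZ; last exact: square_integrableM.
  rewrite past_increment0 ?mulr0//; apply: measurable_wrt_sub mU.
  by apply: smallest_sub; [exact: smallest_sigma_algebra|exact: G_past].
by apply: square_integrableM => //; exact: square_integrableZ.
Qed.

Definition combination_variance : R := kappa * \sum_i a i ^+ 2.

Lemma combination_variance_ge0 : 0 <= combination_variance.
Proof.
apply: mulr_ge0; first by rewrite fine_ge0// gaussian_moment2_ge0.
by apply: sumr_ge0 => i _; exact: sqr_ge0.
Qed.

(** The square is expanded into a double sum: diagonal terms give [kappa * a i ^ 2 * (t - s)],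
    off-diagonal ones vanish by [past_increment_cross]. *)
Lemma combination_quadratic s t (A : set T) : 0 <= s -> s <= t -> G s A ->
  \int[P]_w (\1_A w * (X t w - X s w) ^+ 2) =
  combination_variance * (t - s) * \int[P]_w \1_A w.
Proof.
move=> s0; rewrite le_eqVlt => /predU1P[-> sA|st sA].
  rewrite subrr mulr0 mul0r.
  under eq_Rintegral do rewrite subrr expr0n mulr0; exact: Rintegral_real_cst.
have Is i := increment_square_integrable i s0 st.
have sjA j : <<s past_box B j s >> A by exact: (G_past s0).
under eq_Rintegral.
  move=> w _; rewrite XB expr2 mulr_suml mulr_sumr.
  under eq_bigr do rewrite mulr_sumr mulr_sumr.
  over.
have int i j : P.-integrable setT (EFin \o (fun w => \1_A w *
    (a i * increment B i s t w * (a j * increment B j s t w)))).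
  apply: integrable_real_indic; first exact: measurable_past (sjA i).
  by apply: square_integrableM; exact: square_integrableZ.
rewrite Rintegral_real_sum => [|i]; last first.
  have := integrable_sum measurableT (index_enum 'I_n)
    (fun j (_ : true) => int i j).
  by apply: eq_integrable => //= w _; rewrite sumEFin.
rewrite /combination_variance mulr_sumr !mulr_suml; apply: eq_bigr => i _.
rewrite Rintegral_real_sum// (bigD1 i)//= [X in _ + X]big1 ?addr0 => [|j ji].
  transitivity (\int[P]_w (a i ^+ 2 * (\1_A w * increment B i s t w ^+ 2))).
    by apply: eq_Rintegral => w _; ring.
  rewrite Rintegral_realZ; last first.
    apply: integrable_real_indic; first exact: measurable_past (sjA i).
    exact: (Is i).2.
  by rewrite past_increment_sqr//; ring.
transitivity (\int[P]_w (a i * a j *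
    (\1_A w * (increment B i s t w * increment B j s t w)))).
  by apply: eq_Rintegral => w _; ring.
rewrite Rintegral_realZ; last first.
  apply: integrable_real_indic; first exact: measurable_past (sjA i).
  exact: square_integrableM.
by rewrite past_increment_cross ?mulr0// eq_sym.
Qed.

End brownian_increments.

(** * Optional stopping on a grid *)

Section grid_stopping.
Context (R : realType) (d : measure_display) (T : measurableType d).
Variable P : probability T R.

(* All that the proof uses of Brownian motion: centred orthogonal increments with
   conditional variance [v * (t - s)], and continuous paths. *)
Record linear_bracket_martingale (G : R -> set (set T)) (X : R -> T -> R)
    (v : R) : Prop := {
  lbm_sigma_algebra : forall t, sigma_algebra setT (G t);
  lbm_filtration : forall s t, s <= t -> G s `<=` G t;
  lbm_measurable : forall t, G t `<=` measurable;
  lbm_start : forall w, X 0 w = 0;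
  lbm_continuous : forall w, {within `[0, +oo[, continuous (X ^~ w)};
  lbm_adapted : forall t, 0 <= t -> measurable_wrt (G t) (X t);
  lbm_square_integrable : forall t, 0 <= t -> square_integrable P (X t);
  lbm_bracket_ge0 : 0 <= v;
  lbm_martingale : forall s t U, 0 <= s -> s <= t ->
    square_integrable P U -> measurable_wrt (G s) U ->
    \int[P]_w (U w * (X t w - X s w)) = 0;
  lbm_bracket : forall s t A, 0 <= s -> s <= t -> G s A ->
    \int[P]_w (\1_A w * (X t w - X s w) ^+ 2) = v * (t - s) * \int[P]_w \1_A w
}.

Variables (G : R -> set (set T)) (X : R -> T -> R) (v : R).
Hypothesis HX : linear_bracket_martingale G X v.

Lemma measurable_wrt_indic (t : R) (A : set T) : G t A ->
  measurable_wrt (G t) (\1_A : T -> R).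
Proof.
move=> GA; apply: (@measurable_indic _ (g_sigma_algebraType (G t))).
by rewrite measurable_g_measurableTypeE//; exact: lbm_sigma_algebra HX t.
Qed.

Lemma measurable_wrt_set (t : R) (U : T -> R) (A : set R) :
  measurable_wrt (G t) U -> measurable A -> G t (U @^-1` A).
Proof.
move=> mU mA; have := measurable_wrt_preimage mU mA.
by rewrite sigma_algebra_id//; exact: lbm_sigma_algebra HX t.
Qed.

Lemma measurable_wrt_le (s t : R) (U : T -> R) : s <= t ->
  measurable_wrt (G s) U -> measurable_wrt (G t) U.
Proof.
move=> st; apply: measurable_wrt_sub; apply: sub_sigma_algebra2.
exact: lbm_filtration HX _ _ st.
Qed.

Lemma filtrationI (t : R) (A A' : set T) : G t A -> G t A' -> G t (A `&` A').
Proof. exact: (sigma_algebraI (lbm_sigma_algebra HX t)). Qed.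

Lemma filtrationC (t : R) (A : set T) : G t A -> G t (~` A).
Proof. by have [_ GC _] := lbm_sigma_algebra HX t => /GC; rewrite setTD. Qed.

Lemma filtration_set0 (t : R) : G t set0.
Proof. by have [] := lbm_sigma_algebra HX t. Qed.

Lemma lbm_sqr (t : R) : 0 <= t -> \int[P]_w (X t w ^+ 2) = v * t.
Proof.
move=> t0; have GT := sigma_algebra_setT (lbm_sigma_algebra HX 0).
have := lbm_bracket HX (lexx 0) t0 GT.
rewrite subr0; under eq_Rintegral do rewrite indicT mul1r (lbm_start HX) subr0.
under [in RHS]eq_Rintegral do rewrite indicT.
by rewrite Rintegral_real_cst mulr1.
Qed.

Variables (h : R) (rho : T -> nat) (J : nat).
Hypothesis h_ge0 : 0 <= h.
Hypothesis rho_le : forall w, (rho w <= J)%N.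
Hypothesis rho_stop : forall j, G (j%:R * h) [set w | rho w = j].

(* Measurability in the sigma-algebra of the past of the grid time [rho * h]. *)
Definition stopped_measurable (Z : T -> R) : Prop :=
  forall j, measurable_wrt (G (j%:R * h))
    (fun w => \1_[set w | rho w = j] w * Z w).

Definition stopped (w : T) : R := X ((rho w)%:R * h) w.

Let L : R := J%:R * h.

Let time_ge0 j : 0 <= j%:R * h. Proof. by rewrite mulr_ge0. Qed.

Let mrho j : measurable [set w | rho w = j].
Proof. exact: (lbm_measurable HX (rho_stop j)). Qed.

(** The events [rho = j] with [j <= J] partition the space; this reduces each statement about the
    random time to finitely many deterministic times. *)
Lemma grid_sum (f : T -> R) (w : T) :
  f w = \sum_(j < J.+1) \1_[set w | rho w = j] w * f w.
Proof.
rewrite -mulr_suml (bigD1 (Ordinal (rho_le w : (rho w < J.+1)%N)))//=.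
rewrite [X in _ + X]big1 ?addr0 => [|i /eqP ne].
  by rewrite indicE mem_set// mul1r.
by rewrite indicE memNset//= => e; apply: ne; exact/val_inj.
Qed.

Lemma Rintegral_grid (f : T -> R) : P.-integrable setT (EFin \o f) ->
  \int[P]_w f w =
  \sum_(j < J.+1) \int[P]_w (\1_[set w | rho w = j] w * f w).
Proof.
move=> fi; rewrite -Rintegral_real_sum => [|j].
  by apply: eq_Rintegral => w _; rewrite -grid_sum.
exact: integrable_real_indic.
Qed.

Lemma indic_grid (j : nat) (f g : T -> R) (w : T) :
  (rho w = j -> f w = g w) ->
  \1_[set w | rho w = j] w * f w = \1_[set w | rho w = j] w * g w.
Proof.
move=> fg; rewrite indicE; have [e|e] := pselect (rho w = j).
  by rewrite fg.
by rewrite memNset// !mul0r.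
Qed.

Lemma stopped_square_integrable : square_integrable P stopped.
Proof.
have -> : stopped =
    (fun w => \sum_(j < J.+1) \1_[set w | rho w = j] w * X (j%:R * h) w).
  apply/funext => w; rewrite [LHS](grid_sum stopped).
  by apply: eq_bigr => j _; apply: indic_grid => e; rewrite /stopped e.
apply: square_integrable_sum => j; apply: square_integrable_indic => //.
exact: (lbm_square_integrable HX).
Qed.

Lemma stopped_measurable_stopped : stopped_measurable stopped.
Proof.
move=> j; have -> : (fun w => \1_[set w | rho w = j] w * stopped w) =
    (fun w => \1_[set w | rho w = j] w * X (j%:R * h) w).
  by apply/funext => w; apply: indic_grid => e; rewrite /stopped e.
apply: (measurable_funM (measurable_wrt_indic (rho_stop j))).
exact: (lbm_adapted HX).
Qed.

Lemma stopped_measurable_fun (phi : nat -> R) :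
  stopped_measurable (fun w => phi (rho w)).
Proof.
move=> j; have -> : (fun w => \1_[set w | rho w = j] w * phi (rho w)) =
    (fun w => \1_[set w | rho w = j] w * phi j).
  by apply/funext => w; apply: (@indic_grid j (phi \o rho) (fun=> phi j)) => /= ->.
apply: (measurable_funM (measurable_wrt_indic (rho_stop j))).
exact: measurable_cst.
Qed.

Lemma stopped_measurableD (Y Z : T -> R) : stopped_measurable Y ->
  stopped_measurable Z -> stopped_measurable (fun w => Y w + Z w).
Proof.
move=> mY mZ j; under eq_fun do rewrite mulrDr.
exact: (measurable_funD (mY j) (mZ j)).
Qed.

Lemma grid_fun_square_integrable (phi : nat -> R) :
  square_integrable P (fun w => phi (rho w)).
Proof.
have -> : (fun w => phi (rho w)) =
    (fun w => \sum_(j < J.+1) \1_[set w | rho w = j] w * phi j).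
  apply/funext => w; rewrite [LHS](grid_sum (fun w => phi (rho w))).
  apply: eq_bigr => j _.
  by apply: (@indic_grid j (phi \o rho) (fun=> phi j)) => /= ->.
apply: square_integrable_sum => j; apply: square_integrable_indic => //.
exact: square_integrable_cst.
Qed.

Let time_le (j : 'I_J.+1) : j%:R * h <= L.
Proof. by rewrite ler_wpM2r// ler_nat -ltnS. Qed.

(** On [rho = j] the increment starts at the deterministic time [j * h], and [Z] cut to this event
    is observed by then; the martingale property applies to each piece. *)
Lemma optional_stopping_orthogonal (Z : T -> R) : square_integrable P Z ->
  stopped_measurable Z -> \int[P]_w (Z w * (X L w - stopped w)) = 0.
Proof.
move=> Zs mZ; rewrite Rintegral_grid; last first.
  apply: square_integrableM => //; apply: square_integrableB.
    exact: (lbm_square_integrable HX (time_ge0 J)).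
  exact: stopped_square_integrable.
apply: big1 => j _.
rewrite -[RHS](@lbm_martingale _ _ _ HX (j%:R * h) L
  (fun w => \1_[set w | rho w = j] w * Z w))//.
- apply: eq_Rintegral => w _; rewrite -mulrA.
  apply: (@indic_grid j (fun w => Z w * (X L w - stopped w))
    (fun w => Z w * (X L w - X (j%:R * h) w))) => e.
  by rewrite /stopped e.
- exact: square_integrable_indic.
Qed.

(** [A] has to be observed by the time [rho] only. This freedom is used for events such as
    [sigma < k] and [k <= sigma], which are not decided at every grid point. *)
Lemma optional_stopping_bracket (A : set T) : measurable A ->
  (forall j, G (j%:R * h) (A `&` [set w | rho w = j])) ->
  \int[P]_w (\1_A w * (X L w - stopped w) ^+ 2) =
  v * \int[P]_w (\1_A w * (L - (rho w)%:R * h)).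
Proof.
move=> mA GA.
have Ls := lbm_square_integrable HX (time_ge0 J).
rewrite Rintegral_grid; last first.
  apply: integrable_real_indic => //.
  exact: (square_integrableB Ls stopped_square_integrable).2.
have iA : P.-integrable setT (EFin \o (fun w => \1_A w * (L - (rho w)%:R * h))).
  apply: integrable_real_indic => //; apply: square_integrable_integrable.
  exact: (grid_fun_square_integrable (fun j => L - j%:R * h)).
rewrite (Rintegral_grid iA) mulr_sumr; apply: eq_bigr => j _.
have indAj w : \1_[set w | rho w = j] w * \1_A w =
    \1_(A `&` [set w | rho w = j]) w :> R.
  by rewrite [in RHS]indicI/= mulrC.
transitivity (\int[P]_w (\1_(A `&` [set w | rho w = j]) w *
    (X L w - X (j%:R * h) w) ^+ 2)).
  apply: eq_Rintegral => w _; rewrite -indAj -!mulrA.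
  apply: (@indic_grid j (fun w => \1_A w * (X L w - stopped w) ^+ 2)
    (fun w => \1_A w * (X L w - X (j%:R * h) w) ^+ 2)) => e.
  by rewrite /stopped e.
rewrite (lbm_bracket HX)// -mulrA; congr (_ * _).
rewrite -Rintegral_realZ; last first.
  by apply: integrable_indic => //; exact: measurableI.
apply: eq_Rintegral => w _; rewrite -indAj [LHS]mulrC -mulrA.
apply: (@indic_grid j (fun w => \1_A w * (L - j%:R * h))
  (fun w => \1_A w * (L - (rho w)%:R * h))) => /= e.
by rewrite e.
Qed.

End grid_stopping.

(** * Bounded optional times *)

(** Serves to discard a rounding error proportional to the mesh of the grid. *)
Lemma ge0_of_harmonic_ge0 (R : realType) (x y : R) :
  (forall m : nat, 0 <= x + m.+1%:R^-1 * y) -> 0 <= x.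
Proof.
move=> h; have hc : x + harmonic m * y @[m --> \oo] --> x.
  rewrite -[X in _ --> X]addr0 -[X in x + X](mul0r y).
  by apply: cvgD; [exact: cvg_cst|apply: cvgMl; exact: cvg_harmonic].
rewrite -(cvg_lim _ hc)//; apply: limr_ge; first by apply/cvg_ex; exists x.
by apply: nearW => m; exact: h.
Qed.

Section bounded_optional_time.
Context (R : realType) (d : measure_display) (T : measurableType d).
Variable P : probability T R.
Variables (G : R -> set (set T)) (X : R -> T -> R) (v : R).
Hypothesis HX : linear_bracket_martingale P G X v.

(** Strict inequality is what upward rounding sees: the rounded time is at most [j * h] exactly when
    [sigma < j * h]. *)
Definition optional_time (sigma : T -> R) : Prop :=
  forall t, G t [set w | sigma w < t].

Variables (sigma : T -> R) (K : nat).
Hypothesis sigma_ge0 : forall w, 0 <= sigma w.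
Hypothesis sigma_le : forall w, sigma w <= K%:R.
Hypothesis sigma_opt : optional_time sigma.

Definition grid_step (m : nat) : R := m.+1%:R^-1.

(** The successor is taken even when [sigma w] lies on the grid, so that the rounded time is
    strictly later than [sigma w], by at most one step. *)
Definition grid_time (m : nat) (w : T) : nat :=
  (Num.truncn (m.+1%:R * sigma w)).+1.

(** One unit beyond the cap: a grid step is at most 1, so every rounded time stays below [L], and
    [L] belongs to every grid. *)
Let L : R := K.+1%:R.
Let J (m : nat) : nat := (m.+1 * K.+1)%N.

Lemma grid_step_gt0 m : 0 < grid_step m. Proof. by rewrite invr_gt0. Qed.

Lemma grid_step_le1 m : grid_step m <= 1.
Proof. by rewrite invf_le1// ler1n. Qed.

Lemma grid_horizon m : (J m)%:R * grid_step m = L.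
Proof. by rewrite /J natrM mulrAC divff ?mul1r. Qed.

Lemma grid_time_bounds m w :
  sigma w < (grid_time m w)%:R * grid_step m <= sigma w + grid_step m.
Proof.
have /truncn_itv/andP[lo hi] : 0 <= m.+1%:R * sigma w by rewrite mulr_ge0.
rewrite /grid_step ltr_pdivlMr// mulrC hi/= ler_pdivrMr// mulrDl mulVf//.
by rewrite -[(Num.truncn _).+1%:R]natr1 lerD2r [leRHS]mulrC.
Qed.

Lemma grid_time_le m w : (grid_time m w <= J m)%N.
Proof.
rewrite -(ler_nat R) -(ler_pM2r (grid_step_gt0 m)) grid_horizon.
have /andP[_ /le_trans->//] := grid_time_bounds m w.
by rewrite /L -natr1 lerD// grid_step_le1.
Qed.

Lemma grid_time_lt m w j : (grid_time m w <= j)%N = (sigma w < j%:R * grid_step m).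
Proof.
rewrite /grid_time truncn_lt_nat ?mulr_ge0//.
by rewrite /grid_step ltr_pdivlMr// mulrC.
Qed.

Lemma grid_time_stop m j :
  G (j%:R * grid_step m) [set w | grid_time m w = j].
Proof.
(* At [j = 0] the truncated predecessor is harmless: [grid_time] is a successor, and both sides are
   empty. *)
have -> : [set w | grid_time m w = j] =
    [set w | sigma w < j%:R * grid_step m] `&`
    ~` [set w | sigma w < j.-1%:R * grid_step m].
  apply/seteqP; split=> [w /= e|w /=]; rewrite -!grid_time_lt.
    split; first by rewrite e.
    by rewrite e; case: j e => // j _ /=; rewrite ltnn.
  move=> [lo /negP]; rewrite -ltnNge => hi; apply/eqP; rewrite eqn_leq lo/=.
  by case: j hi {lo} => // j.
apply: (filtrationI HX) => //; apply: (filtrationC HX).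
apply: (lbm_filtration HX) (sigma_opt _).
apply: ler_wpM2r; first exact/ltW/grid_step_gt0.
by rewrite ler_nat leq_pred.
Qed.

Lemma sigma_measurable_wrt_lt t : measurable [set w | sigma w < t].
Proof. exact: (lbm_measurable HX (sigma_opt t)). Qed.

Lemma sigma_measurable : measurable_fun setT sigma.
Proof.
apply: (measurability _ (RGenInftyO.measurableE R)) => // _ [_ [t ->] <-].
rewrite setTI; have -> : sigma @^-1` `]-oo, t[ = [set w | sigma w < t].
  by apply/seteqP; split => w /=; rewrite in_itv.
exact: sigma_measurable_wrt_lt.
Qed.

Lemma bounded_square_integrable (f : T -> R) (c : R) : measurable_fun setT f ->
  (forall w, `|f w| <= c) -> square_integrable P f.
Proof.
move=> mf fc; apply: le_square_integrable (square_integrable_cst P c) => // w.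
exact: le_trans (fc w) (ler_norm c).
Qed.

Lemma sigma_square_integrable : square_integrable P sigma.
Proof.
apply: (bounded_square_integrable sigma_measurable (c := K%:R)) => w.
by rewrite ger0_norm.
Qed.

Let Xgrid m := stopped X (grid_step m) (grid_time m).
Let rho m w : R := (grid_time m w)%:R * grid_step m.

Let step_ge0 m : 0 <= grid_step m. Proof. exact/ltW/grid_step_gt0. Qed.

Let rho_sq m : square_integrable P (rho m).
Proof.
exact: (grid_fun_square_integrable HX (grid_time_le m) (grid_time_stop m)
  (fun j => j%:R * grid_step m)).
Qed.

Let Xgrid_sq m : square_integrable P (Xgrid m).
Proof.
exact: (stopped_square_integrable HX (step_ge0 m) (grid_time_le m)
  (grid_time_stop m)).
Qed.

Let XL_sq : square_integrable P (X L).
Proof. exact: (lbm_square_integrable HX). Qed.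

Lemma grid_orthogonal m (Z : T -> R) : square_integrable P Z ->
  stopped_measurable G (grid_step m) (grid_time m) Z ->
  \int[P]_w (Z w * (X L w - Xgrid m w)) = 0.
Proof.
move=> Zs mZ; rewrite -(grid_horizon m).
exact: (optional_stopping_orthogonal HX (step_ge0 m) (grid_time_le m)
  (grid_time_stop m)).
Qed.

Lemma grid_bracket m (A : set T) : measurable A ->
  (forall j, G (j%:R * grid_step m) (A `&` [set w | grid_time m w = j])) ->
  \int[P]_w (\1_A w * (X L w - Xgrid m w) ^+ 2) =
  v * \int[P]_w (\1_A w * (L - rho m w)).
Proof.
move=> mA GA; rewrite -(grid_horizon m).
exact: (optional_stopping_bracket HX (step_ge0 m) (grid_time_le m)
  (grid_time_stop m)).
Qed.

Lemma grid_bracketT m :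
  \int[P]_w ((X L w - Xgrid m w) ^+ 2) = v * \int[P]_w (L - rho m w).
Proof.
have E (f : T -> R) : \int[P]_w f w = \int[P]_w (\1_setT w * f w).
  by apply: eq_Rintegral => w _; rewrite indicT mul1r.
rewrite E [in RHS]E; apply: grid_bracket => // j; rewrite setTI.
exact: grid_time_stop.
Qed.

(* Pythagoras: [X L - Xgrid m] is orthogonal to every variable observed by the
   grid time. *)
Lemma grid_pythagoras m (Z : T -> R) : square_integrable P Z ->
  stopped_measurable G (grid_step m) (grid_time m) Z ->
  \int[P]_w ((X L w - Xgrid m w + Z w) ^+ 2) =
  v * \int[P]_w (L - rho m w) + \int[P]_w (Z w ^+ 2).
Proof.
move=> Zs mZ; have Ds := square_integrableB XL_sq (Xgrid_sq m).
rewrite -grid_bracketT -[X in X + _]addr0 -(mulr0 2) -(grid_orthogonal Zs mZ).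
rewrite -Rintegral_realZ; last exact: square_integrableM.
rewrite -RintegralD//; [|exact: Ds.2|]; last first.
  apply: integrable_realZ; exact: square_integrableM.
rewrite -RintegralD//; [|apply: integrable_realD; [exact: Ds.2|]|exact: Zs.2].
  by apply: eq_Rintegral => w _; ring.
apply: integrable_realZ; exact: square_integrableM.
Qed.

(** Pythagoras with [Z = Xgrid m]: the left side becomes [E (X L ^ 2) = v * L], and [v * L]
    cancels. *)
Lemma stopped_value_sqr m : \int[P]_w (Xgrid m w ^+ 2) = v * \int[P]_w rho m w.
Proof.
have h := grid_pythagoras (Xgrid_sq m)
  (stopped_measurable_stopped HX (step_ge0 m) (grid_time_stop m)).
have iL : P.-integrable setT (EFin \o (fun=> L)) by exact: integrable_real_cst.
have ir := square_integrable_integrable (rho_sq m).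
rewrite RintegralB// Rintegral_real_cst in h.
have hL := lbm_sqr HX (ler0n R K.+1).
move: h; under eq_Rintegral do rewrite subrK.
by rewrite hL -/L => h; lra.
Qed.

(** If [sigma] is replaced by its rounding [rho m], Pythagoras turns the integral into [E (Z ^ 2)]
    with [Z] the stopped value of [X + mu * t - M]. The replacement costs at most one grid step
    times an integrable function. *)
Theorem bounded_optional_lower (mu M : R) :
  0 <= \int[P]_w ((X L w + mu * sigma w - M) ^+ 2 - v * (L - sigma w)).
Proof.
have v0 := lbm_bracket_ge0 HX.
pose a w := X L w + mu * sigma w - M.
have as_ : square_integrable P a.
  apply: square_integrableB (square_integrable_cst P M).
  apply: square_integrableD => //; apply: square_integrableZ.
  exact: sigma_square_integrable.
pose f w := a w ^+ 2 - v * (L - sigma w).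
have if_ : P.-integrable setT (EFin \o f).
  apply: integrable_realB; first exact: as_.2.
  apply: integrable_realZ; apply: integrable_realB; first exact: integrable_real_cst.
  exact: square_integrable_integrable sigma_square_integrable.
(* With [dl = rho m - sigma], replacing [sigma] adds [2 * a * mu * dl + mu ^ 2 * dl ^ 2 + v * dl];
   as [0 <= dl <= grid_step m <= 1], this is at most [grid_step m * g]. *)
pose g w := 2 * (`|mu| * `|a w|) + (mu ^+ 2 + v).
have ig : P.-integrable setT (EFin \o g).
  apply: integrable_realD; last exact: integrable_real_cst.
  do 2 apply: integrable_realZ.
  exact: integrable_norm (square_integrable_integrable as_).
apply: (@ge0_of_harmonic_ge0 _ _ (\int[P]_w g w)) => m.
rewrite -Rintegral_realZ// -RintegralD//; last exact: integrable_realZ.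
pose Z w := Xgrid m w + (mu * rho m w - M).
have Zs : square_integrable P Z.
  apply: square_integrableD => //.
  apply: square_integrableB (square_integrable_cst P M).
  exact: square_integrableZ.
have mZ : stopped_measurable G (grid_step m) (grid_time m) Z.
  apply: stopped_measurableD.
    exact: (stopped_measurable_stopped HX (step_ge0 m) (grid_time_stop m)).
  exact: (stopped_measurable_fun HX (grid_time_stop m)
    (fun j => mu * (j%:R * grid_step m) - M)).
have bs : square_integrable P (fun w => X L w - Xgrid m w + Z w).
  by apply: square_integrableD => //; exact: square_integrableB.
have ib : P.-integrable setT (EFin \o (fun w => v * (L - rho m w))).
  apply: integrable_realZ; apply: integrable_realB; first exact: integrable_real_cst.
  exact: square_integrable_integrable.
apply: (@le_trans _ _
    (\int[P]_w ((X L w - Xgrid m w + Z w) ^+ 2 - v * (L - rho m w)))).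
  rewrite RintegralB//; last exact: bs.2.
  rewrite grid_pythagoras// Rintegral_realZ; last first.
    apply: integrable_realB; first exact: integrable_real_cst.
    exact: square_integrable_integrable.
  rewrite addrAC subrr add0r; apply: Rintegral_ge0 => w _; exact: sqr_ge0.
apply: le_Rintegral => //.
- by apply: integrable_realB => //; exact: bs.2.
- by apply: integrable_realD => //; exact: integrable_realZ.
move=> w _; have /andP[lo hi] := grid_time_bounds m w.
pose dl := rho m w - sigma w.
have d0 : 0 <= dl by rewrite subr_ge0 ltW.
have dh : dl <= grid_step m by rewrite lerBlDl.
have d1 : dl <= 1 by exact: le_trans dh (grid_step_le1 m).
have -> : X L w - Xgrid m w + Z w = a w + mu * dl.
  by rewrite /Z /a /dl; ring.
have -> : rho m w = sigma w + dl by rewrite /dl; ring.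
rewrite -/(f w) /f -/(grid_step m) /g.
have h1 : a w * mu <= `|mu| * `|a w|.
  by rewrite -normrM mulrC; exact: ler_norm.
have h2 : a w * mu * dl <= `|mu| * `|a w| * grid_step m.
  apply: (@le_trans _ _ (`|mu| * `|a w| * dl)); first exact: ler_wpM2r.
  by apply: ler_wpM2l => //; exact: mulr_ge0.
have h3 : mu ^+ 2 * dl ^+ 2 <= mu ^+ 2 * grid_step m.
  apply: ler_wpM2l; first exact: sqr_ge0.
  by apply: le_trans dh; rewrite expr2 ler_piMl.
have h4 : v * dl <= v * grid_step m by apply: ler_wpM2l.
by nra.
Qed.

End bounded_optional_time.

Section fatou_real.
Context (R : realType) (d : measure_display) (T : measurableType d).
Variable P : probability T R.

(** Integrability of the limit is part of the conclusion: this is how moments at random times are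
    obtained without a dominating function. *)
Lemma fatou_real (f_ : nat -> T -> R) (f : T -> R) (c : R) :
  (forall n w, 0 <= f_ n w) -> (forall w, f_ n w @[n --> \oo] --> f w) ->
  (forall n, P.-integrable setT (EFin \o f_ n)) ->
  (forall n, \int[P]_w f_ n w <= c) ->
  P.-integrable setT (EFin \o f) /\ \int[P]_w f w <= c.
Proof.
move=> f0 ff fi fc.
have mf_ n : measurable_fun setT (f_ n) := integrable_real_measurable (fi n).
have mf : measurable_fun setT f.
  by apply: (measurable_fun_cvg mf_) => w _; exact: ff.
have f0' w : 0 <= f w.
  rewrite -(cvg_lim _ (ff w))//; apply: limr_ge; first by apply/cvg_ex; exists (f w).
  by apply: nearW => n; exact: f0.
have le_c : (\int[P]_w (f w)%:E <= c%:E)%E.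
  have := @fatou _ _ _ P setT measurableT (fun n w => (f_ n w)%:E).
  have -> : (\int[P]_w limn_einf (fun n => (f_ n w)%:E) = \int[P]_w (f w)%:E)%E.
    apply: eq_integral => w _.
    have : (fun n => (f_ n w)%:E) @ \oo --> (f w)%:E.
      by apply/fine_cvgP; split; [exact: nearW|exact: ff].
    by move=> /cvg_limn_einf_sup[].
  move=> h; apply: le_trans (h _ _) _.
  - by move=> n; apply/measurable_EFinP.
  - by move=> n w _; rewrite lee_fin.
  rewrite limn_einf_lim; apply: lime_le; first exact: is_cvg_einfs.
  apply: nearW => n; apply: (@le_trans _ _ (\int[P]_w (f_ n w)%:E)%E).
    by apply: ereal_inf_lbound; exists n => /=.
  by rewrite Rintegral_EFin ?lee_fin.
have int : P.-integrable setT (EFin \o f).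
  apply/integrableP; split; first exact/measurable_EFinP.
  under eq_integral do rewrite /= ger0_norm//.
  by apply: le_lt_trans le_c _; rewrite ltry.
by split=> //; rewrite -lee_fin -Rintegral_EFin.
Qed.

Lemma within_nonneg_cvg (f : R -> R) (u : nat -> R) (x : R) :
  {within `[0, +oo[, continuous f} -> 0 <= x -> (forall n, 0 <= u n) ->
  u n @[n --> \oo] --> x -> f (u n) @[n --> \oo] --> f x.
Proof.
move=> /subspace_continuousP cf x0 u0 ux.
have Ax : `[0, +oo[%classic x by rewrite /= in_itv/= andbT.
move=> A /(cf x Ax) /= h; have {}h := ux _ h; rewrite /nbhs/= /nbhs/=.
have {}h : \oo [set m | `[0, +oo[%classic (u m) -> A (f (u m))] := h.
apply: filterS h => m; apply.
by rewrite /= in_itv/= andbT.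
Qed.

End fatou_real.

(** * Moment bounds at a bounded optional time, by Fatou's lemma along the grids *)

Section optional_time_bounds.
Context (R : realType) (d : measure_display) (T : measurableType d).
Variable P : probability T R.
Variables (G : R -> set (set T)) (X : R -> T -> R) (v : R).
Hypothesis HX : linear_bracket_martingale P G X v.
Variables (sigma : T -> R) (K : nat).
Hypothesis sigma_ge0 : forall w, 0 <= sigma w.
Hypothesis sigma_le : forall w, sigma w <= K%:R.
Hypothesis sigma_opt : optional_time G sigma.

Let L : R := K.+1%:R.
Let rho m w : R := (grid_time sigma m w)%:R * grid_step R m.
Let Xrho m := stopped X (grid_step R m) (grid_time sigma m).
Let step_ge0 m : 0 <= grid_step R m. Proof. exact/ltW/grid_step_gt0. Qed.
Let rho_stop m := grid_time_stop HX sigma_ge0 sigma_opt m.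
Let rho_le m := grid_time_le sigma_ge0 sigma_le m.
Let msigma := sigma_measurable HX sigma_opt.
Let Xrho_sq m : square_integrable P (Xrho m).
Proof. exact: (stopped_square_integrable HX (step_ge0 m) (rho_le m) (rho_stop m)). Qed.
Let XL_sq : square_integrable P (X L).
Proof. exact: (lbm_square_integrable HX). Qed.
Let rho_int m : P.-integrable setT (EFin \o rho m).
Proof.
apply: square_integrable_integrable.
exact: (grid_fun_square_integrable HX (rho_le m) (rho_stop m)
  (fun j => j%:R * grid_step R m)).
Qed.
Let sigma_int : P.-integrable setT (EFin \o sigma).
Proof.
apply: square_integrable_integrable.
exact: (sigma_square_integrable HX sigma_ge0 sigma_le sigma_opt).
Qed.

Let rho_bounds m w : sigma w < rho m w <= sigma w + grid_step R m.
Proof. exact: grid_time_bounds. Qed.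

Lemma optional_time_ge (t : R) : G t [set w | t <= sigma w].
Proof.
have -> : [set w | t <= sigma w] = ~` [set w | sigma w < t].
  by apply/seteqP; split=> w /=; rewrite leNgt => /negP.
exact: (filtrationC HX (sigma_opt t)).
Qed.

(** A submartingale inequality proved by testing with a sign. With [zeta] the sign of [X u] cut to
    [u <= sigma], both [E (zeta * X u)] and [E (zeta * Xrho 0)] equal [E (zeta * X L)]; the first is
    the left side and the second is at most the right side. *)
Lemma optional_time_abs_le (u : R) : 0 <= u -> u <= L ->
  \int[P]_w (\1_[set w | u <= sigma w] w * `|X u w|) <=
  \int[P]_w (\1_[set w | u <= sigma w] w * `|Xrho 0 w|).
Proof.
move=> u0 uL; set A := [set w | u <= sigma w].
have GA : G u A := optional_time_ge u.
have mA : measurable A := lbm_measurable HX GA.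
pose C := [set w | 0 <= X u w].
have GC : G u C.
  have := measurable_wrt_set HX (lbm_adapted HX u0) (measurable_itv `[0, +oo[).
  by congr (G u _); apply/seteqP; split=> w /=; rewrite in_itv/= andbT.
pose zeta w : R := \1_A w * (2 * \1_C w - 1).
have mzeta : measurable_wrt (G u) zeta.
  apply: (measurable_funM (measurable_wrt_indic HX GA)).
  apply: (@measurable_funB _ (g_sigma_algebraType (G u))) => //.
  exact: (measurable_funM (measurable_cst _ ) (measurable_wrt_indic HX GC)).
have zeta1 w : `|zeta w| <= \1_A w.
  rewrite /zeta normrM ger0_norm ?indicE// ler_piMr//.
  by case: (_ \in C); rewrite /= ?mulr1n ?mulr0n ?mulr1 ?mulr0 ler_norml;
    apply/andP; split; lra.
have zetaM : measurable_fun setT zeta.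
  exact: (measurable_wrt_measurable (lbm_measurable HX (t:=u)) mzeta).
have zeta_sq : square_integrable P zeta.
  apply: (@bounded_square_integrable _ _ _ P zeta 1) => // w.
  by apply: le_trans (zeta1 w) _; rewrite indicE lern1 leq_b1.
have zX w : \1_A w * `|X u w| = zeta w * X u w.
  rewrite /zeta -mulrA; congr (_ * _); rewrite indicE.
  have [Xu|Xu] := leP 0 (X u w).
    by rewrite mem_set// ger0_norm//= mulr1; ring.
  rewrite memNset ?ltr0_norm//= ?mulr0 ?sub0r ?mulN1r// => /(lt_le_trans Xu).
  by rewrite ltxx.
have Xu_sq : square_integrable P (X u) := lbm_square_integrable HX u0.
have izL := square_integrableM zeta_sq XL_sq.
have izu := square_integrableM zeta_sq Xu_sq.
have izr := square_integrableM zeta_sq (Xrho_sq 0).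
have e1 : \int[P]_w (zeta w * X u w) = \int[P]_w (zeta w * X L w).
  apply/eqP; rewrite eq_sym -subr_eq0 -RintegralB//; apply/eqP.
  rewrite -[RHS](lbm_martingale HX u0 uL zeta_sq mzeta).
  by apply: eq_Rintegral => w _; rewrite mulrBr.
have e2 : \int[P]_w (zeta w * X L w) = \int[P]_w (zeta w * Xrho 0 w).
  apply/eqP; rewrite -subr_eq0 -RintegralB//; apply/eqP.
  rewrite -[RHS](@grid_orthogonal _ _ _ _ _ _ _ HX _ _ sigma_ge0 sigma_le
    sigma_opt 0 zeta zeta_sq).
    by apply: eq_Rintegral => w _; rewrite mulrBr.
  (* [zeta] is known at time [u], hence at grid points from [u] on. Before [u] it vanishes on the
     event considered, because [sigma < rho 0 < u] there. *)
  move=> j; have [uj|ju] := leP u (j%:R * grid_step R 0).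
    apply: (measurable_funM (measurable_wrt_indic HX (rho_stop 0 j))).
    exact: (measurable_wrt_le HX uj mzeta).
  have -> : (fun w => \1_[set w | grid_time sigma 0 w = j] w * zeta w) = cst 0.
    apply/funext => w /=; rewrite indicE.
    have [e|e] := pselect (grid_time sigma 0 w = j); last by rewrite memNset// mul0r.
    have /andP[+ _] := rho_bounds 0 w; rewrite /rho e => lt.
    have nA : ~ A w.
      by move=> us; have := lt_trans (le_lt_trans us lt) ju; rewrite ltxx.
    have -> : zeta w = 0 by rewrite /zeta [\1_A w]indicE (memNset nA) mul0r.
    by rewrite mulr0.
  exact: measurable_cst.
under eq_Rintegral do rewrite zX.
rewrite e1 e2; apply: le_Rintegral => //.
  apply: integrable_real_indic => //.
  exact: (integrable_norm (square_integrable_integrable (Xrho_sq 0))).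
move=> w _; apply: le_trans (ler_norm _) _; rewrite normrM.
exact: ler_wpM2r.
Qed.

(** Grid 0 has step 1, hence the [+ 1]. The bound depends on the cap only through the mean of
    [sigma]. *)
Lemma stopped_value_sqr0 : \int[P]_w (Xrho 0 w ^+ 2) <= v * (\int[P]_w sigma w + 1).
Proof.
rewrite (stopped_value_sqr HX sigma_ge0 sigma_le sigma_opt).
apply: ler_wpM2l; first exact: (lbm_bracket_ge0 HX).
rewrite -[X in _ + X](Rintegral_real_cst P 1) -RintegralD//;
  last exact: integrable_real_cst.
apply: le_Rintegral => //.
- exact: (rho_int 0).
- by apply: integrable_realD => //; exact: integrable_real_cst.
move=> w _; have /andP[_ le] := rho_bounds 0 w; apply: (le_trans le).
by rewrite lerD2l grid_step_le1.
Qed.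

Lemma rho_cvg w : rho m w @[m --> \oo] --> sigma w.
Proof.
apply: (@squeeze_cvgr _ _ _ _ (fun=> sigma w) (fun m => sigma w + harmonic m)).
- apply: nearW => m; have /andP[lo hi] := rho_bounds m w.
  by rewrite ltW//=.
- exact: cvg_cst.
- rewrite -[X in _ --> X]addr0; apply: cvgD; first exact: cvg_cst.
  exact: cvg_harmonic.
Qed.

Lemma Xrho_cvg w : Xrho m w @[m --> \oo] --> X (sigma w) w.
Proof.
have r0 m : 0 <= rho m w by rewrite mulr_ge0.
exact: (@within_nonneg_cvg _ (X ^~ w) _ _ (@lbm_continuous _ _ _ _ _ _ _ HX w)
  (sigma_ge0 w) r0 (@rho_cvg w)).
Qed.

(** Fatou applied to the bracket identities on the grids, where [L - rho m <= L - sigma]. The event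
    [A] is admissible: from [k] on it is observed, and at an earlier grid point [rho m = j * h < k]
    forces [sigma < k], so the whole piece lies in [A]. *)
Lemma before_bracket_le (k : nat) : (k <= K)%N ->
  let A := [set w | sigma w < k%:R] in
  P.-integrable setT (EFin \o (fun w => \1_A w * (X L w - X (sigma w) w) ^+ 2)) /\
  \int[P]_w (\1_A w * (X L w - X (sigma w) w) ^+ 2) <=
  v * \int[P]_w (\1_A w * (L - sigma w)).
Proof.
move=> kK A; have mA : measurable A := lbm_measurable HX (sigma_opt k%:R).
have iLs (f : T -> R) : P.-integrable setT (EFin \o f) ->
    P.-integrable setT (EFin \o (fun w => \1_A w * (L - f w))).
  move=> fi; apply: integrable_real_indic => //.
  by apply: integrable_realB => //; exact: integrable_real_cst.
apply: (fatou_real (f_ := fun m w => \1_A w * (X L w - Xrho m w) ^+ 2)).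
- by move=> m w; rewrite mulr_ge0 ?sqr_ge0.
- move=> w; apply: cvgMr; apply: (cvg_comp _ (fun x => x ^+ 2)).
    by apply: cvgB; [exact: cvg_cst|exact: Xrho_cvg].
  exact: exprn_continuous.
- move=> m; apply: integrable_real_indic => //.
  by have [] := square_integrableB XL_sq (Xrho_sq m).
move=> m; rewrite (grid_bracket HX sigma_ge0 sigma_le sigma_opt) => // [|j].
  apply: ler_wpM2l; first exact: (lbm_bracket_ge0 HX).
  apply: le_Rintegral => //; [exact: (iLs _ (rho_int m))|exact: iLs|].
  move=> w _; rewrite ler_wpM2l// lerD2l lerN2.
  by have /andP[/ltW] := rho_bounds m w.
have [kj|jk] := leP k%:R (j%:R * grid_step R m).
  apply: (filtrationI HX) (rho_stop m j).
  exact: (lbm_filtration HX kj (sigma_opt _)).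
rewrite setIidr; first exact: rho_stop.
move=> w /= e; rewrite /A /=; have /andP[+ _] := rho_bounds m w.
by rewrite /rho e => /lt_trans; exact.
Qed.

(** On [A], split [X L - X k] at the grid time as [E + D]. The brackets of [X L - X k] and of [E]
    are known and the cross term vanishes, so [D] has bracket [v * (rho m - k)]. Then
    [rho m <= sigma + 1], and Fatou removes the grid. *)
Lemma after_bracket_le (k : nat) : (k <= K)%N ->
  let A := [set w | k%:R <= sigma w] in
  P.-integrable setT (EFin \o (fun w => \1_A w * (X (sigma w) w - X k%:R w) ^+ 2)) /\
  \int[P]_w (\1_A w * (X (sigma w) w - X k%:R w) ^+ 2) <=
  v * \int[P]_w (\1_A w * (sigma w + 1 - k%:R)).
Proof.
move=> kK A; have GA : G k%:R A := optional_time_ge k%:R.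
have mA : measurable A := lbm_measurable HX GA.
have v0 := lbm_bracket_ge0 HX.
have Xk_sq : square_integrable P (X k%:R) by exact: (lbm_square_integrable HX).
have iA (f : T -> R) (c : R) : P.-integrable setT (EFin \o f) ->
    P.-integrable setT (EFin \o (fun w => \1_A w * (f w - c))).
  move=> fi; apply: integrable_real_indic => //.
  by apply: integrable_realB => //; exact: integrable_real_cst.
have iLA (f : T -> R) : P.-integrable setT (EFin \o f) ->
    P.-integrable setT (EFin \o (fun w => \1_A w * (L - f w))).
  move=> fi; apply: integrable_real_indic => //.
  by apply: integrable_realB => //; exact: integrable_real_cst.
apply: (fatou_real (f_ := fun m w => \1_A w * (Xrho m w - X k%:R w) ^+ 2)).
- by move=> m w; rewrite mulr_ge0 ?sqr_ge0.
- move=> w; apply: cvgMr; apply: (cvg_comp _ (fun x => x ^+ 2)).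
    by apply: cvgB; [exact: Xrho_cvg|exact: cvg_cst].
  exact: exprn_continuous.
- move=> m; apply: integrable_real_indic => //.
  by have [] := square_integrableB (Xrho_sq m) Xk_sq.
move=> m; pose D w := Xrho m w - X k%:R w.
have D_sq : square_integrable P D by exact: square_integrableB.
pose E w := X L w - Xrho m w.
have E_sq : square_integrable P E by exact: square_integrableB.
pose Z w := \1_A w * D w.
have Z_sq : square_integrable P Z by exact: square_integrable_indic.
(* Rounding is strict, so on [k <= sigma] the grid time exceeds [k]: grid points up to [k]
   contribute nothing and [A] is observed at all others. *)
have on_rho j : j%:R * grid_step R m <= k%:R ->
    A `&` [set w | grid_time sigma m w = j] = set0.
  move=> jk; apply/seteqP; split=> // w [/= kw e].
  have /andP[+ _] := rho_bounds m w; rewrite /rho e => lt.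
  by have := lt_le_trans (le_lt_trans kw lt) jk; rewrite ltxx.
have ZE : \int[P]_w (Z w * E w) = 0.
  apply: (grid_orthogonal HX sigma_ge0 sigma_le sigma_opt) => // j.
  have [jk|kj] := leP (j%:R * grid_step R m) k%:R.
    have -> : (fun w => \1_[set w | grid_time sigma m w = j] w * Z w) = cst 0.
      apply/funext => w /=; rewrite /Z mulrA [X in X * _]mulrC.
      have -> : \1_A w * \1_[set w | grid_time sigma m w = j] w =
          \1_(A `&` [set w | grid_time sigma m w = j]) w :> R by rewrite indicI.
      by rewrite on_rho// indic0 mul0r.
    exact: measurable_cst.
  have -> : (fun w => \1_[set w | grid_time sigma m w = j] w * Z w) =
      (fun w => \1_[set w | grid_time sigma m w = j] w *
        (\1_A w * (X (j%:R * grid_step R m) w - X k%:R w))).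
    apply/funext => w; apply: (@indic_grid _ _ _ (grid_time sigma m) j Z
      (fun w => \1_A w * (X (j%:R * grid_step R m) w - X k%:R w))) => e.
    by rewrite /Z /D /Xrho /stopped e.
  apply: (measurable_funM (measurable_wrt_indic HX (rho_stop m j))).
  have kj' := ltW kj.
  apply: (measurable_funM (measurable_wrt_le HX kj' (measurable_wrt_indic HX GA))).
  apply: measurable_funB; first by apply: (lbm_adapted HX); rewrite mulr_ge0.
  by apply: (measurable_wrt_le HX kj'); exact: (lbm_adapted HX).
have brE : \int[P]_w (\1_A w * E w ^+ 2) = v * \int[P]_w (\1_A w * (L - rho m w)).
  apply: (grid_bracket HX sigma_ge0 sigma_le sigma_opt) => // j.
  have [jk|kj] := leP (j%:R * grid_step R m) k%:R.
    by rewrite on_rho//; exact: (filtration_set0 HX _).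
  apply: (filtrationI HX) (rho_stop m j).
  exact: (lbm_filtration HX (ltW kj) GA).
have kL : k%:R <= L by rewrite ler_nat ltnW.
have brL := lbm_bracket HX (ler0n R k) kL GA.
have split_sq : \int[P]_w (\1_A w * (X L w - X k%:R w) ^+ 2) =
    \int[P]_w (\1_A w * E w ^+ 2) + \int[P]_w (\1_A w * D w ^+ 2).
  have iE : P.-integrable setT (EFin \o (fun w => \1_A w * E w ^+ 2)).
    by apply: integrable_real_indic => //; exact: E_sq.2.
  have iD : P.-integrable setT (EFin \o (fun w => \1_A w * D w ^+ 2)).
    by apply: integrable_real_indic => //; exact: D_sq.2.
  have iZE := square_integrableM Z_sq E_sq.
  have iZE2 := integrable_realZ 2 iZE.
  rewrite -[X in X + _]addr0 -(mulr0 2) -ZE -Rintegral_realZ//.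
  rewrite -RintegralD// -RintegralD//; last exact: integrable_realD.
  by apply: eq_Rintegral => w _; rewrite /Z /E /D; ring.
have -> : \int[P]_w (\1_A w * (Xrho m w - X k%:R w) ^+ 2) =
    v * \int[P]_w (\1_A w * (rho m w - k%:R)).
  apply: (@addrI _ (\int[P]_w (\1_A w * E w ^+ 2))).
  rewrite -split_sq brL brE -mulrDr -RintegralD//; [|exact: iLA|exact: iA].
  rewrite -mulrA; congr (_ * _); rewrite -Rintegral_realZ//; last first.
    exact: integrable_indic.
  by apply: eq_Rintegral => w _; ring.
apply: ler_wpM2l => //; apply: le_Rintegral => //; first exact: iA.
  by apply: iA; apply: integrable_realD => //; exact: integrable_real_cst.
move=> w _; rewrite ler_wpM2l// lerD2r.
have /andP[_ le] := rho_bounds m w; apply: (le_trans le).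
by rewrite lerD2l grid_step_le1.
Qed.

End optional_time_bounds.

(** * Exchange of expectation and time integral *)

Section joint_measurability.
Context (R : realType) (d : measure_display) (T : measurableType d).
Local Notation mu := (@lebesgue_measure R).

(** Freezing each path at the last grid point before [t] gives a countable union of measurable
    rectangles as preimage; continuity makes these approximations converge. The maximum with 0
    freezes the process at negative times, where nothing is known about it. *)
Lemma joint_measurable (Y : R -> T -> R) :
  (forall t, 0 <= t -> measurable_fun setT (Y t)) ->
  (forall w, {within `[0, +oo[, continuous (Y ^~ w)}) ->
  measurable_fun [set: T * R] (fun z => Y (Num.max 0 z.2) z.1).
Proof.
move=> mY cY.
have mmax : measurable_fun [set: T * R] (fun z : T * R => Num.max 0 z.2).
  exact: measurable_maxr.
have max0 (z : T * R) : 0 <= Num.max 0 z.2 by rewrite le_max lexx.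
pose k (m : nat) (z : T * R) := Num.truncn (m.+1%:R * Num.max 0 z.2).
apply: (@measurable_fun_cvg _ _ _ _
  (fun m z => Y ((k m z)%:R / m.+1%:R) z.1)); last first.
  move=> z _.
  have u0 m : 0 <= (k m z)%:R / m.+1%:R :> R by rewrite divr_ge0.
  apply: (@within_nonneg_cvg _ (Y ^~ z.1) (fun m => (k m z)%:R / m.+1%:R)
    _ (cY z.1) (max0 z) u0).
  apply: (@squeeze_cvgr _ _ _ _ (fun m => Num.max 0 z.2 - harmonic m)
    (fun=> Num.max 0 z.2)); last exact: cvg_cst.
    apply: nearW => m; have p0 : 0 <= m.+1%:R * Num.max 0 z.2.
      by rewrite mulr_ge0.
    have /andP[lo hi] := truncn_itv p0.
    rewrite ler_pdivlMr// ler_pdivrMr// mulrC mulrBr divff//.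
    by rewrite [Num.max 0 z.2 * _]mulrC lo andbT lerBlDr natr1 ltW.
  rewrite -[X in _ --> X]subr0; apply: cvgB; first exact: cvg_cst.
  exact: cvg_harmonic.
move=> m _ A mA; rewrite setTI.
have -> : (fun z => Y ((k m z)%:R / m.+1%:R) z.1) @^-1` A =
    \bigcup_j ([set z | k m z = j] `&` fst @^-1` (Y (j%:R / m.+1%:R) @^-1` A)).
  apply/seteqP; split=> [z /= Az|z [j _ [/= <-]]//].
  by exists (k m z).
apply: bigcupT_measurable => j; apply: measurableI.
  have -> : [set z | k m z = j] =
      (fun z : T * R => m.+1%:R * Num.max 0 z.2) @^-1` `[j%:R, j.+1%:R[%classic.
    apply/seteqP; split=> z /=; rewrite in_itv/=.
      by move=> <-; apply: truncn_itv; rewrite mulr_ge0.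
    have p0 : 0 <= m.+1%:R * Num.max 0 z.2 by rewrite mulr_ge0.
    rewrite -truncn_ge_nat// -truncn_lt_nat// ltnS => /andP[h1 h2].
    by apply/eqP; rewrite eqn_leq h1 h2.
  rewrite -[X in measurable X]setTI; apply: measurable_funM => //.
rewrite -[X in measurable X]setTI; apply: measurable_fst => //.
rewrite -[X in measurable X]setTI; apply: mY => //.
Qed.

(** Treating positive and negative parts separately covers sections whose integral is infinite or
    ill-defined, as may happen where a stopping time is [+oo]. *)
Lemma measurable_inner_integral (f : T * R -> \bar R) :
  measurable_fun setT f ->
  measurable_fun setT (fun w => \int[mu]_u f (w, u))%E.
Proof.
move=> mf; rewrite [X in measurable_fun _ X](_ : _ = (fun w =>
  \int[mu]_u f^\+ (w, u) - \int[mu]_u f^\- (w, u))%E); last first.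
  apply/funext => w; rewrite integralE.
  by congr (_ - _)%E; apply: eq_integral => u _; rewrite ?funeposE ?funenegE.
apply: emeasurable_funB.
  by apply: (@measurable_fun_fubini_tonelli_F _ _ _ _ _ mu (f^\+)%E) => //;
    exact: measurable_funepos.
by apply: (@measurable_fun_fubini_tonelli_F _ _ _ _ _ mu (f^\-)%E) => //;
  exact: measurable_funeneg.
Qed.

End joint_measurability.

Section swap_integrals.
Context (R : realType) (d : measure_display) (T : measurableType d).
Variable P : probability T R.
Local Notation mu := (@lebesgue_measure R).
Variables (G : R -> set (set T)) (X : R -> T -> R) (v : R).
Hypothesis HX : linear_bracket_martingale P G X v.
Variables (sigma : T -> R) (K : nat).
Hypothesis sigma_ge0 : forall w, 0 <= sigma w.
Hypothesis sigma_le : forall w, sigma w <= K%:R.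
Hypothesis sigma_opt : optional_time G sigma.

Let L : R := K.+1%:R.
Let msigma := sigma_measurable HX sigma_opt.
Let sigma_sq := sigma_square_integrable HX sigma_ge0 sigma_le sigma_opt.
Let XL_sq : square_integrable P (X L).
Proof. exact: (lbm_square_integrable HX). Qed.

Let D := [set z : T * R | 0 <= z.2 <= sigma z.1].

Let mD : measurable D.
Proof.
have h : measurable_fun setT (fun z : T * R => (0 <= z.2) && (z.2 <= sigma z.1)).
  by apply: measurable_and; apply: measurable_fun_ler => //; exact: measurableT_comp.
by have := h measurableT [set true] I; rewrite setTI; congr measurable;
  apply/seteqP; split=> z.
Qed.

Let region_time w u : \1_D (w, u) = \1_`[0, sigma w]%classic u :> R.
Proof.
by rewrite !indicE; congr (nat_of_bool _)%:R; apply/idP/idP;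
  rewrite !inE /= in_itv.
Qed.

Let region_sample w u : 0 <= u ->
  \1_D (w, u) = \1_[set w | u <= sigma w] w :> R.
Proof.
by move=> u0; rewrite !indicE; congr (nat_of_bool _)%:R; apply/idP/idP;
  rewrite !inE /D /= u0.
Qed.

Let region0 w u : ~ (0 <= u <= K%:R) -> \1_D (w, u) = 0 :> R.
Proof.
move=> nu; rewrite indicE memNset//= => /andP[u0 us]; apply: nu.
by rewrite u0 (le_trans us).
Qed.

Let mX : measurable_fun [set: T * R] (fun z => X (Num.max 0 z.2) z.1).
Proof.
apply: joint_measurable; last exact: (lbm_continuous HX).
by move=> t t0; have [] := lbm_square_integrable HX t0.
Qed.

Let inner (q : T * R -> R) w :
  (\int[mu]_u (\1_D (w, u) * q (w, u))%:E =
   \int[mu]_(u in `[0%R, sigma w]) (q (w, u))%:E)%E.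
Proof.
rewrite [RHS]integral_mkcond; apply: eq_integral => u _.
rewrite region_time patchE indicE; case: ifPn => _; first by rewrite mul1r.
by rewrite mul0r.
Qed.

Lemma measure_itv0 (s : R) : 0 <= s -> mu `[0, s] = s%:E.
Proof.
move=> s0; rewrite lebesgue_measure_itv/= lte_fin; case: ltP => [_|s0'].
  by rewrite oppr0 adde0.
by congr EFin; apply/eqP; rewrite eq_le s0 s0'.
Qed.

(** Under Tonelli, [optional_time_abs_le] replaces [|X u|] by a variable [Y] free of [u], so the
    time integral collapses to [sigma * Y <= sigma ^ 2 + Y ^ 2]. The bound sees the cap only through
    moments of [sigma], which allows the passage to unbounded times. *)
Lemma expectation_area_abs_le :
  (\int[P]_w \int[mu]_(u in `[0%R, sigma w]) `|X u w|%:E <=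
   (\int[P]_w sigma w ^+ 2 + v * (\int[P]_w sigma w + 1))%:E)%E.
Proof.
pose Y w := `|stopped X (grid_step R 0) (grid_time sigma 0) w|.
have Xr_sq : square_integrable P (stopped X (grid_step R 0) (grid_time sigma 0)).
  apply: (stopped_square_integrable HX (ltW (grid_step_gt0 R 0))
    (grid_time_le sigma_ge0 sigma_le 0) (grid_time_stop HX sigma_ge0 sigma_opt 0)).
have iY : P.-integrable setT (EFin \o Y).
  exact: (integrable_norm (square_integrable_integrable Xr_sq)).
have mY : measurable_fun setT Y := integrable_real_measurable iY.
have mq1 : measurable_fun setT
    (fun z : T * R => (\1_D z * `|X (Num.max 0 z.2) z.1|)%:E).
  apply/measurable_EFinP/measurable_funM; first exact: measurable_indic.
  exact: measurableT_comp.
have mq2 : measurable_fun setT (fun z : T * R => (\1_D z * Y z.1)%:E).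
  apply/measurable_EFinP/measurable_funM; first exact: measurable_indic.
  exact: measurableT_comp.
have -> : (\int[P]_w \int[mu]_(u in `[0%R, sigma w]) `|X u w|%:E =
    \int[P]_w \int[mu]_u (\1_D (w, u) * `|X (Num.max 0 u) w|)%:E)%E.
  apply: eq_integral => w _; rewrite (inner (fun z => `|X (Num.max 0 z.2) z.1|)).
  apply: eq_integral => u; rewrite inE/= in_itv/= => /andP[u0 _].
  by rewrite (max_idPr u0).
rewrite (@fubini_tonelli _ _ _ _ _ P mu
  (fun z => (\1_D z * `|X (Num.max 0 z.2) z.1|)%:E))//.
apply: (@le_trans _ _ (\int[mu]_u \int[P]_w (\1_D (w, u) * Y w)%:E)%E).
  apply: ge0_le_integral => //.
  - by move=> u _; apply: integral_ge0 => w _; rewrite lee_fin mulr_ge0.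
  - apply: (@measurable_fun_fubini_tonelli_G _ _ _ _ _ P
      (fun z : T * R => (\1_D z * `|X (Num.max 0 z.2) z.1|)%:E)) => //.
  - apply: (@measurable_fun_fubini_tonelli_G _ _ _ _ _ P
      (fun z : T * R => (\1_D z * Y z.1)%:E)) => // z.
    by rewrite lee_fin mulr_ge0 /Y.
  - move=> u _; have [/andP[u0 uK]|nu] := boolP (0 <= u <= K%:R); last first.
      have z0 (q : T -> R) : (\int[P]_w (\1_D (w, u) * q w)%:E = 0)%E.
        by apply: integral0_eq => w _; rewrite region0 ?mul0r//; exact/negP.
      by rewrite !z0.
    have uL : u <= L by rewrite (le_trans uK)// ler_nat.
    have := optional_time_abs_le HX sigma_ge0 sigma_le sigma_opt u0 uL.
    have mA : measurable [set w | u <= sigma w].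
      exact: (lbm_measurable HX (optional_time_ge HX sigma_opt u)).
    have zA (q : T -> R) : (\int[P]_w (\1_D (w, u) * q w)%:E =
        \int[P]_w (\1_[set w | (u <= sigma w)%R] w * q w)%:E)%E.
      by apply: eq_integral => w _; rewrite region_sample.
    rewrite /= (max_idPr u0) !zA.
    rewrite !Rintegral_EFin ?lee_fin//.
    + exact: integrable_real_indic.
    + apply: integrable_real_indic => //.
      exact: (integrable_norm (square_integrable_integrable
        (lbm_square_integrable HX u0))).
rewrite -(@fubini_tonelli _ _ _ _ _ P mu (fun z => (\1_D z * Y z.1)%:E))//;
  last by move=> z; rewrite lee_fin mulr_ge0 /Y.
under eq_integral do
  rewrite (inner (fun z => Y z.1))/= integral_cst//= measure_itv0// -EFinM.
have iYs : P.-integrable setT (EFin \o (fun w => sigma w ^+ 2 + Y w ^+ 2)).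
  apply: integrable_realD; first exact: sigma_sq.2.
  apply: eq_integrable Xr_sq.2 => //= w _.
  by rewrite /Y real_normK ?num_real.
apply: (@le_trans _ _ (\int[P]_w (sigma w ^+ 2 + Y w ^+ 2)%:E)%E).
  apply: ge0_le_integral => //.
  - by move=> w _; rewrite lee_fin mulr_ge0 /Y.
  - by apply/measurable_EFinP/measurable_funM.
  - exact: measurable_int iYs.
  - move=> w _; rewrite lee_fin.
    have := sqr_ge0 (sigma w - Y w); have := sqr_ge0 (sigma w + Y w); nra.
rewrite Rintegral_EFin// lee_fin RintegralD//; [|exact: sigma_sq.2|].
  rewrite lerD2l; apply: le_trans (stopped_value_sqr0 HX sigma_ge0 sigma_le sigma_opt).
  rewrite le_eqVlt; apply/orP; left; apply/eqP; apply: eq_Rintegral => w _.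
  by rewrite /Y real_normK ?num_real.
apply: eq_integrable Xr_sq.2 => //= w _.
by rewrite /Y real_normK ?num_real.
Qed.

(** At a fixed [u] the event [u <= sigma] belongs to [G u], so [X u] may be replaced by [X L] there;
    the time integral of the indicator is then [sigma]. *)
Lemma expectation_area :
  P.-integrable setT (fun w => \int[mu]_(u in `[0%R, sigma w]) (X u w)%:E)%E /\
  (\int[P]_w \int[mu]_(u in `[0%R, sigma w]) (X u w)%:E =
   (\int[P]_w (sigma w * X L w))%:E)%E.
Proof.
have v0 := lbm_bracket_ge0 HX.
have mXL : measurable_fun setT (X L) by case: XL_sq.
pose f (z : T * R) : \bar R := (\1_D z * X (Num.max 0 z.2) z.1)%:E.
pose g (z : T * R) : \bar R := (\1_D z * X L z.1)%:E.
have mf : measurable_fun setT f.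
  by apply/measurable_EFinP/measurable_funM; first exact: measurable_indic.
have mg : measurable_fun setT g.
  apply/measurable_EFinP/measurable_funM; first exact: measurable_indic.
  exact: measurableT_comp.
have innerf w : (\int[mu]_u f (w, u) =
    \int[mu]_(u in `[0%R, sigma w]) (X u w)%:E)%E.
  rewrite /f (inner (fun z => X (Num.max 0 z.2) z.1)).
  apply: eq_integral => u; rewrite inE/= in_itv/= => /andP[u0 _].
  by rewrite (max_idPr u0).
have innerg w : (\int[mu]_u g (w, u) = (sigma w * X L w)%:E)%E.
  rewrite /g (inner (fun z => X L z.1))/= integral_cst//= measure_itv0// -EFinM.
  by rewrite mulrC.
(* From [|x| <= 1 + x ^ 2] and [E (X t ^ 2) = v * t <= v * L]. It justifies Fubini twice: with
   [t = u] for [f] and with [t = L] for [g]. *)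
have bound t u : 0 <= t -> t <= L ->
    (\int[P]_w `|(\1_D (w, u) * X t w)%:E| <=
      (\1_`[0%R, K%:R] u * (1 + v * L))%:E)%E.
  move=> t0 tL; have [/andP[u0 uK]|nu] := boolP (0 <= u <= K%:R); last first.
    rewrite integral0_eq ?lee_fin ?mulr_ge0 ?addr_ge0 ?mulr_ge0//.
    by move=> w _; rewrite region0 ?mul0r ?abse0//; exact/negP.
  have Xt := lbm_square_integrable HX t0.
  have i2 : P.-integrable setT (EFin \o (fun w => 1 + X t w ^+ 2)).
    by apply: integrable_realD; [exact: integrable_real_cst|exact: Xt.2].
  apply: (@le_trans _ _ (\int[P]_w (1 + X t w ^+ 2)%:E)%E).
    apply: ge0_le_integral => //.
    - apply: measurableT_comp => //; apply/measurable_EFinP/measurable_funM.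
        have mA := lbm_measurable HX (optional_time_ge HX sigma_opt u).
        rewrite [X in measurable_fun _ X](_ : _ = \1_[set w | u <= sigma w]).
          exact: measurable_indic.
        by apply/funext => w; rewrite region_sample.
      exact: Xt.1.
    - exact: measurable_int i2.
    - move=> w _; rewrite /= lee_fin normrM ger0_norm//.
      apply: (@le_trans _ _ `|X t w|).
        by rewrite ler_piMl// indicE lern1 leq_b1.
      rewrite -[X t w ^+ 2]real_normK ?num_real//.
      have := sqr_ge0 (`|X t w| - 1); nra.
  rewrite Rintegral_EFin// RintegralD//; [|exact: integrable_real_cst|exact: Xt.2].
  rewrite Rintegral_real_cst (lbm_sqr HX)// indicE mem_set ?mul1r/= ?in_itv/= ?u0//.
  by rewrite lee_fin lerD2l ler_wpM2l.
have bound_fin :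
    (\int[mu]_u (\1_`[0%R, K%:R] u * (1 + v * L))%:E < +oo)%E.
  under eq_integral do rewrite EFinM.
  rewrite ge0_integralZr//.
  - by rewrite integral_indic//= setIT measure_itv0// -EFinM ltry.
  - by apply/measurable_EFinP; exact: measurable_indic.
  - by rewrite lee_fin addr_ge0// mulr_ge0.
have L0 : 0 <= L by [].
have KL : K%:R <= L by rewrite ler_nat.
have mb : measurable_fun setT
    (fun u : R => (\1_`[0%R, K%:R]%classic u * (1 + v * L))%:E).
  by apply/measurable_EFinP/measurable_funM => //; exact: measurable_indic.
have intf : (P \x mu)%E.-integrable setT f.
  apply/(@integrable21ltyP _ _ _ _ _ P mu f mf).
  apply: le_lt_trans bound_fin; apply: ge0_le_integral => //.
  - by move=> u _; exact: integral_ge0.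
  - apply: (@measurable_fun_fubini_tonelli_G _ _ _ _ _ P (abse \o f)).
      exact: measurableT_comp.
    by move=> z; exact: abse_ge0.
  - move=> u _; have [/andP[u0 uK]|nu] := boolP (0 <= u <= K%:R).
      by rewrite /f /= (max_idPr u0); apply: bound => //; exact: le_trans KL.
    rewrite integral0_eq ?lee_fin ?mulr_ge0 ?addr_ge0 ?mulr_ge0//.
    by move=> w _; rewrite /f region0 ?mul0r ?abse0//; exact/negP.
have intg : (P \x mu)%E.-integrable setT g.
  apply/(@integrable21ltyP _ _ _ _ _ P mu g mg).
  apply: le_lt_trans bound_fin; apply: ge0_le_integral => //.
  - by move=> u _; exact: integral_ge0.
  - apply: (@measurable_fun_fubini_tonelli_G _ _ _ _ _ P (abse \o g)).
      exact: measurableT_comp.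
    by move=> z; exact: abse_ge0.
  - by move=> u _; exact: bound.
split.
  by have := integrable_fubini_F intf; congr integrable; apply/funext => w; exact: innerf.
transitivity (\int[P]_w \int[mu]_u f (w, u))%E.
  by apply: eq_integral => w _; rewrite innerf.
rewrite (@Fubini _ _ _ _ _ P mu f intf).
transitivity (\int[mu]_u \int[P]_w g (w, u))%E; last first.
  rewrite -(@Fubini _ _ _ _ _ P mu g intg).
  under eq_integral do rewrite innerg.
  by rewrite Rintegral_EFin//; exact: square_integrableM.
apply: eq_integral => u _; have [/andP[u0 uK]|nu] := boolP (0 <= u <= K%:R); last first.
  by rewrite !integral0_eq// => w _; rewrite /f /g region0 ?mul0r//; exact/negP.
have GA := optional_time_ge HX sigma_opt u.
have mA := lbm_measurable HX GA.
have uL : u <= L by exact: le_trans KL.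
have i1 : P.-integrable setT (EFin \o (fun w => \1_[set w | u <= sigma w] w * X u w)).
  apply: integrable_real_indic => //; apply: square_integrable_integrable.
  exact: (lbm_square_integrable HX).
have i2 : P.-integrable setT (EFin \o (fun w => \1_[set w | u <= sigma w] w * X L w)).
  by apply: integrable_real_indic => //; exact: square_integrable_integrable.
transitivity (\int[P]_w (\1_[set w | (u <= sigma w)%R] w * X u w)%:E)%E.
  by apply: eq_integral => w _; rewrite /f/= (max_idPr u0) region_sample.
transitivity (\int[P]_w (\1_[set w | (u <= sigma w)%R] w * X L w)%:E)%E; last first.
  by apply: eq_integral => w _; rewrite /g region_sample.
rewrite !Rintegral_EFin//; congr EFin.
apply/eqP; rewrite eq_sym -subr_eq0 -RintegralB//; apply/eqP.
have A_sq : square_integrable P (\1_[set w | u <= sigma w] : T -> R).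
  apply: (@bounded_square_integrable _ _ _ P _ 1); first exact: measurable_indic.
  by move=> w; rewrite ger0_norm// indicE lern1 leq_b1.
rewrite -[RHS](lbm_martingale HX u0 uL A_sq (measurable_wrt_indic HX GA)).
by apply: eq_Rintegral => w _; rewrite mulrBr.
Qed.

End swap_integrals.

(** * Unbounded stopping times *)

Section dominated_real.
Context (R : realType) (d : measure_display) (T : measurableType d).
Variable P : probability T R.

Lemma dominated_real (N : set T) (f_ : nat -> T -> R) (f g : T -> R) :
  measurable N -> P (~` N) = 0%E ->
  (forall n, measurable_fun setT (f_ n)) -> measurable_fun setT f ->
  (forall w, N w -> f_ n w @[n --> \oo] --> f w) ->
  P.-integrable setT (EFin \o g) ->
  (forall n w, N w -> `|f_ n w| <= g w) ->
  P.-integrable setT (EFin \o f) /\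
  \int[P]_w f_ n w @[n --> \oo] --> \int[P]_w f w.
Proof.
move=> mN N0 mf_ mf ff ig fg.
have aeN (Q : T -> Prop) : (forall w, N w -> Q w) -> {ae P, forall w, Q w}.
  move=> h; exists (~` N); split=> //; first exact: measurableC.
  by move=> w nQ Nw; apply: nQ; exact: h.
have [||||if_ _ cv] := @dominated_convergence _ _ _ P setT measurableT
  (fun n => EFin \o f_ n) (EFin \o f) (EFin \o g) _ _ _ ig.
- by move=> n; exact/measurable_EFinP.
- exact/measurable_EFinP.
- apply: aeN => w Nw _; apply/fine_cvgP; split; first exact: nearW.
  exact: ff.
- by apply: aeN => w Nw n _ /=; rewrite lee_fin; exact: fg.
split=> //; rewrite /Rintegral.
apply: fine_cvg; rewrite [X in _ --> X](_ : _ = \int[P]_w (f w)%:E)%E//.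
by rewrite fineK//; exact: integrable_fin_num.
Qed.

Lemma le_Rintegral_on (N : set T) (f g : T -> R) :
  measurable N -> P (~` N) = 0%E ->
  P.-integrable setT (EFin \o f) ->
  P.-integrable setT (EFin \o g) -> (forall w, N w -> f w <= g w) ->
  \int[P]_w f w <= \int[P]_w g w.
Proof.
move=> mN N1 fi gi fg.
have E (h : T -> R) : P.-integrable setT (EFin \o h) ->
    \int[P]_w h w = \int[P]_w (\1_N w * h w).
  move=> hi; rewrite /Rintegral; congr fine; apply: ae_eq_integral => //.
  - exact: measurable_int hi.
  - exact: measurable_int (integrable_real_indic mN hi).
  - exists (~` N); split => //; first exact: measurableC.
    move=> w /= nh Nw; apply: nh => _; congr EFin.
    by rewrite indicE mem_set// mul1r.
rewrite E// [leRHS]E//; apply: le_Rintegral => //.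
- exact: integrable_real_indic.
- exact: integrable_real_indic.
move=> w _; rewrite !indicE; have [Nw|Nw] := pselect (N w).
  by rewrite mem_set// !mul1r fg.
by rewrite memNset// !mul0r.
Qed.

End dominated_real.

Section random_area.
Context (R : realType) (d : measure_display) (T : measurableType d).
Local Notation mu := (@lebesgue_measure R).
Variables (Y : R -> T -> R).
Hypothesis mY : forall t, 0 <= t -> measurable_fun setT (Y t).
Hypothesis cY : forall w, {within `[0, +oo[, continuous (Y ^~ w)}.

Lemma measurable_area (tau : T -> \bar R) : measurable_fun setT tau ->
  measurable_fun setT (fun w =>
    \int[mu]_(u in [set u : R | (0 <= u)%R /\ (u%:E <= tau w)%E]) (Y u w)%:E)%E.
Proof.
move=> mtau; pose D := [set z : T * R | 0 <= z.2 /\ (z.2%:E <= tau z.1)%E].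
have mD : measurable D.
  apply: measurableI.
    have h : measurable_fun setT (fun z : T * R => 0 <= z.2).
      by apply: measurable_fun_ler.
    by have := h measurableT [set true] I; rewrite setTI; congr measurable;
      apply/seteqP; split=> z.
  rewrite -[X in measurable X]setTI.
  apply: measurable_lee => //; last exact: measurableT_comp.
  by apply: measurableT_comp => //; exact: measurable_snd.
pose f (z : T * R) : \bar R := (\1_D z * Y (Num.max 0 z.2) z.1)%:E.
have mf : measurable_fun setT f.
  apply/measurable_EFinP/measurable_funM; first exact: measurable_indic.
  exact: joint_measurable.
apply: eq_measurable_fun (measurable_inner_integral mf) => w _.
rewrite [RHS]integral_mkcond; apply: eq_integral => u _.
rewrite patchE /f indicE; case: ifPn => [|nu].
  rewrite inE/= => -[u0 ut]; rewrite mem_set//= (max_idPr u0) mul1r//.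
by rewrite memNset ?mul0r// => -[u0 ut]; move/negP: nu; apply; rewrite inE.
Qed.

Lemma path_integrable (w : T) (s : R) : mu.-integrable `[0, s] (EFin \o (Y ^~ w)).
Proof.
apply: continuous_compact_integrable; first exact: segment_compact.
apply: (@continuous_subspaceW _ _ _ _ (Y ^~ w) _ (@cY w)).
by move=> x /=; rewrite !in_itv/= => /andP[->].
Qed.

Lemma area_set (s : R) :
  [set u : R | (0 <= u)%R /\ (u%:E <= s%:E)%E] = `[0, s]%classic.
Proof.
apply/seteqP; split=> u /=; rewrite in_itv/= lee_fin; first by case=> -> ->.
by move/andP.
Qed.

End random_area.

Section capped_time.
Context (R : realType) (d : measure_display) (T : measurableType d).
Variable P : probability T R.
Variables (G : R -> set (set T)) (X : R -> T -> R) (v : R).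
Hypothesis HX : linear_bracket_martingale P G X v.
Variable tau : T -> \bar R.
Hypothesis tau_stop : stopping_time G tau.

Definition cap (K : nat) (w : T) : R := fine (mine (tau w) K%:R%:E).

Lemma cap_fin K w : (cap K w)%:E = mine (tau w) K%:R%:E.
Proof.
rewrite fineK// ge0_fin_numE; last first.
  by rewrite le_min lee_fin ler0n andbT; exact: tau_stop.1.
by rewrite gt_min ltry orbT.
Qed.

Lemma cap_ge0 K w : 0 <= cap K w.
Proof.
by rewrite -lee_fin cap_fin le_min lee_fin ler0n andbT; exact: tau_stop.1.
Qed.

Lemma cap_le K w : cap K w <= K%:R.
Proof. by rewrite -lee_fin cap_fin ge_min lexx orbT. Qed.

(** The event is the union of the events [tau <= t - 1 / (k + 1)]. A stopping time is only
    constrained at non-negative times, so the indices with a negative bound are made to contribute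
    the empty set. *)
Lemma stopping_time_lt t : G t [set w | (tau w < t%:E)%E].
Proof.
have [t0|t0] := leP t 0.
  rewrite [X in G t X](_ : _ = set0); first exact: filtration_set0 HX t.
  apply/seteqP; split=> // w /= lt.
  have := lt_le_trans lt (_ : t%:E <= 0)%E; rewrite lee_fin => /(_ t0).
  by move/lt_geF; rewrite tau_stop.1.
have -> : [set w | (tau w < t%:E)%E] =
    \bigcup_k [set w | 0 <= t - k.+1%:R^-1 /\ (tau w <= (t - k.+1%:R^-1)%:E)%E].
  apply/seteqP; split=> [w /= lt|w [k _ [_ /= le]]].
    have tf : tau w \is a fin_num.
      by rewrite ge0_fin_numE ?tau_stop.1// (lt_trans lt) ?ltry.
    have lt' : fine (tau w) < t by rewrite -lte_fin fineK.
    have [k hk] := ltr_add_invr lt'.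
    have tk : fine (tau w) <= t - k.+1%:R^-1 by rewrite lerBrDr ltW.
    exists k => //; split; last by rewrite -(fineK tf) lee_fin.
    by apply: le_trans tk; rewrite fine_ge0// tau_stop.1.
  by apply: le_lt_trans le _; rewrite lte_fin ltrBlDr ltrDl invr_gt0.
have [_ _ GU] := lbm_sigma_algebra HX t; apply: GU => k.
have [k0|k0] := leP 0 (t - k.+1%:R^-1).
  rewrite [X in G t X](_ : _ = [set w | (tau w <= (t - k.+1%:R^-1)%:E)%E]).
    have kt : t - k.+1%:R^-1 <= t by rewrite lerBlDr lerDl invr_ge0.
    exact: (lbm_filtration HX kt (tau_stop.2 _ k0)).
  by apply/seteqP; split=> w /= => [[]|].
rewrite [X in G t X](_ : _ = set0); first exact: (filtration_set0 HX t).
by apply/seteqP; split=> [w []|].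
Qed.

Lemma cap_optional K : optional_time G (cap K).
Proof.
move=> t; have [Kt|tK] := ltP K%:R t.
  rewrite [X in G t X](_ : _ = setT).
    exact: (sigma_algebra_setT (lbm_sigma_algebra HX t)).
  by apply/seteqP; split=> // w _ /=; apply: le_lt_trans (cap_le K w) Kt.
rewrite [X in G t X](_ : _ = [set w | (tau w < t%:E)%E]).
  exact: stopping_time_lt.
apply/seteqP; split=> w /=; rewrite -lte_fin cap_fin gt_min.
  by move=> /orP[//|]; rewrite lte_fin ltNge tK.
by move=> ->.
Qed.

Lemma stopping_time_measurable : measurable_fun setT tau.
Proof.
apply: (measurability _ (ErealGenInftyO.measurableE R)) => // _ [_ [t ->] <-].
rewrite setTI; have -> : tau @^-1` `]-oo, t%:E[%classic = [set w | (tau w < t%:E)%E].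
  by apply/seteqP; split => w /=; rewrite in_itv.
exact: (lbm_measurable HX (stopping_time_lt t)).
Qed.

Lemma cap_fine K w : (tau w < +oo)%E -> (fine (tau w) <= K%:R) ->
  cap K w = fine (tau w).
Proof.
move=> toy le; apply: EFin_inj; rewrite cap_fin fineK; last first.
  by rewrite ge0_fin_numE ?tau_stop.1.
by apply/min_idPl; rewrite -(@fineK _ (tau w)) ?lee_fin// ge0_fin_numE ?tau_stop.1.
Qed.

Lemma cap_le_fine K w : (tau w < +oo)%E -> cap K w <= fine (tau w).
Proof.
move=> toy; rewrite -lee_fin cap_fin fineK ?ge_min ?lexx//.
by rewrite ge0_fin_numE ?tau_stop.1.
Qed.

End capped_time.

Section unbounded_stopping_time.
Context (R : realType) (d : measure_display) (T : measurableType d).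
Variable P : probability T R.
Local Notation mu := (@lebesgue_measure R).
Variables (G : R -> set (set T)) (X : R -> T -> R) (v : R).
Hypothesis HX : linear_bracket_martingale P G X v.
Variable tau : T -> \bar R.
Hypothesis tau_stop : stopping_time G tau.

Definition area (s : R) (w : T) : R := \int[mu]_(u in `[0, s]) X u w.
Definition abs_area (s : R) (w : T) : R := \int[mu]_(u in `[0, s]) `|X u w|.

Let mX t (t0 : 0 <= t) : measurable_fun setT (X t).
Proof. by case: (lbm_square_integrable HX t0). Qed.
Let cX : forall w, {within `[0, +oo[, continuous (X ^~ w)}.
Proof. exact: (lbm_continuous HX). Qed.
Let mabsX t (t0 : 0 <= t) : measurable_fun setT (fun w => `|X t w|).
Proof. by apply: measurableT_comp => //; exact: mX. Qed.
Let cabsX w : {within `[0, +oo[, continuous (fun t => `|X t w|)}.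
Proof.
move=> x; apply: (@cvg_comp _ _ _ (X ^~ w) (fun x : R => `|x|)).
  exact: cX.
exact: norm_continuous.
Qed.

Lemma areaE s w : (\int[mu]_(u in `[0%R, s]) (X u w)%:E = (area s w)%:E)%E.
Proof. by rewrite fineK//; apply: integrable_fin_num => //; exact: path_integrable. Qed.

Lemma abs_areaE s w :
  (\int[mu]_(u in `[0%R, s]) `|X u w|%:E = (abs_area s w)%:E)%E.
Proof.
rewrite fineK//; apply: integrable_fin_num => //.
exact: (@path_integrable _ _ T (fun u w => `|X u w|) cabsX).
Qed.

Lemma abs_area_ge0 s w : 0 <= abs_area s w.
Proof. by apply: Rintegral_ge0. Qed.

Lemma area_abs_le s w : `|area s w| <= abs_area s w.
Proof. by apply: le_normr_Rintegral => //; exact: path_integrable. Qed.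

Lemma abs_area_le s t w : s <= t -> abs_area s w <= abs_area t w.
Proof.
move=> st; rewrite -lee_fin -!abs_areaE; apply: ge0_subset_integral => //.
- apply/measurable_EFinP.
  have := @path_integrable _ _ T (fun u w => `|X u w|) cabsX w t.
  by move=> /measurable_int/measurable_EFinP.
- by move=> x /=; rewrite !in_itv/= => /andP[-> /le_trans->].
Qed.

Lemma area_measurable (s : T -> R) : measurable_fun setT s ->
  measurable_fun setT (fun w => area (s w) w).
Proof.
move=> ms; apply/measurable_EFinP.
have ms' : measurable_fun setT (EFin \o s) by exact/measurable_EFinP.
apply: eq_measurable_fun (measurable_area mX cX ms') => w _ /=.
by rewrite area_set areaE.
Qed.

Lemma abs_area_measurable (s : T -> R) : measurable_fun setT s ->
  measurable_fun setT (fun w => abs_area (s w) w).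
Proof.
move=> ms; apply/measurable_EFinP.
have ms' : measurable_fun setT (EFin \o s) by exact/measurable_EFinP.
apply: eq_measurable_fun
  (@measurable_area _ _ T (fun u w => `|X u w|) mabsX cabsX _ ms') => w _ /=.
by rewrite area_set abs_areaE.
Qed.

Let sg := cap tau.
Let sg0 := cap_ge0 tau_stop.
Let sgK := cap_le tau_stop.
Let sgO := cap_optional HX tau_stop.
Let msg K := sigma_measurable HX (sgO K).
Let sg_sq K := sigma_square_integrable HX (sg0 K) (sgK K) (sgO K).
Let tr (w : T) : R := fine (tau w).
Let N := [set w | (tau w < +oo)%E].
Let v0 := lbm_bracket_ge0 HX.

Let tr0 w : 0 <= tr w. Proof. by rewrite fine_ge0// tau_stop.1. Qed.

Let mtau := stopping_time_measurable HX tau_stop.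

Lemma fine_tau_measurable : measurable_fun setT tr.
Proof. exact: measurableT_comp. Qed.

Lemma finite_time_measurable : measurable N.
Proof.
have := emeasurable_fun_infty_o measurableT mtau +oo%E.
by rewrite setTI; apply.
Qed.

Let mtr := fine_tau_measurable.
Let mN := finite_time_measurable.

(** On [N] the caps are eventually equal to [tau], so the sequence is eventually constant and [F]
    can be any function, in particular a path or its area. *)
Lemma cap_cvg (F : R -> R) w : N w -> F (sg K w) @[K --> \oo] --> F (tr w).
Proof.
move=> Nw; apply: cvg_near_cst; near=> K; congr F; apply: (cap_fine tau_stop) => //.
near: K; have [m hm] : exists m : nat, tr w <= m%:R.
  by exists (Num.truncn (tr w)).+1; exact/ltW/truncnS_gt.
exists m => // k /= mk; apply: (le_trans hm).
by rewrite ler_nat.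
Unshelve. all: by end_near. Qed.

Section second_moment.
Hypothesis N1 : P (~` N) = 0%E.
Hypothesis tr_sq : square_integrable P tr.

Let tr_int := square_integrable_integrable tr_sq.

(** The constant [c] bounds the capped areas uniformly, and Fatou passes to [tau]. The indicator
    makes convergence hold everywhere: off [N] the caps run to infinity while [fine] gives 0. Being
    monotone in time, this area dominates all the capped ones. *)
Lemma abs_area_integrable :
  P.-integrable setT (EFin \o (fun w => \1_N w * abs_area (tr w) w)).
Proof.
pose c := \int[P]_w tr w ^+ 2 + v * (\int[P]_w tr w + 1).
have ci K : P.-integrable setT (EFin \o (fun w => abs_area (sg K w) w)) /\
    \int[P]_w abs_area (sg K w) w <= c.
  have := expectation_area_abs_le HX (sg0 K) (sgK K) (sgO K).
  under eq_integral do rewrite abs_areaE.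
  move=> le.
  have i : P.-integrable setT (EFin \o (fun w => abs_area (sg K w) w)).
    apply/integrableP; split.
      by apply/measurable_EFinP; exact: abs_area_measurable (msg K).
    under eq_integral do rewrite /= ger0_norm ?abs_area_ge0//.
    by apply: le_lt_trans le _; rewrite ltry.
  split=> //; rewrite -lee_fin -Rintegral_EFin//; apply: le_trans le _.
  rewrite lee_fin; apply: lerD.
    apply: (le_Rintegral_on mN N1); [exact: (sg_sq K).2|exact: tr_sq.2|].
    by move=> w Nw; rewrite lerXn2r ?nnegrE ?sg0//; exact: (cap_le_fine tau_stop).
  apply: ler_wpM2l => //; rewrite lerD2r; apply: (le_Rintegral_on mN N1) => //.
    exact: square_integrable_integrable (sg_sq K).
  by move=> w Nw; exact: (cap_le_fine tau_stop).
have [] := @fatou_real _ _ _ P (fun K w => \1_N w * abs_area (sg K w) w)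
  (fun w => \1_N w * abs_area (tr w) w) c => //.
- by move=> K w; rewrite mulr_ge0// abs_area_ge0.
- move=> w; have [Nw|Nw] := pselect (N w).
    apply: cvgMr; exact: (@cap_cvg (abs_area ^~ w)).
  under eq_fun do rewrite indicE memNset// mul0r.
  rewrite indicE memNset// mul0r; exact: cvg_cst.
- by move=> K; apply: integrable_real_indic => //; exact: (ci K).1.
- move=> K; apply: le_trans (ci K).2; apply: le_Rintegral => //.
  + by apply: integrable_real_indic => //; exact: (ci K).1.
  + exact: (ci K).1.
  + move=> w _; rewrite ler_piMl ?abs_area_ge0//.
Qed.

Lemma area_integrable_cvg :
  P.-integrable setT (EFin \o (fun w => area (tr w) w)) /\
  \int[P]_w area (sg K w) w @[K --> \oo] --> \int[P]_w area (tr w) w.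
Proof.
apply: (@dominated_real _ _ _ P N _ _ (fun w => \1_N w * abs_area (tr w) w)) => //.
- by move=> K; exact: area_measurable (msg K).
- exact: area_measurable mtr.
- by move=> w Nw; exact: (@cap_cvg (area ^~ w)).
- exact: abs_area_integrable.
- move=> K w Nw; rewrite indicE mem_set// mul1r; apply: le_trans (area_abs_le _ _) _.
  by apply: abs_area_le; exact: (cap_le_fine tau_stop).
Qed.

Lemma cap_mean_cvg : \int[P]_w sg K w @[K --> \oo] --> \int[P]_w tr w.
Proof.
have [] := @dominated_real _ _ _ P N sg tr tr => //.
- by move=> w Nw; exact: (@cap_cvg id).
- by move=> K w Nw; rewrite ger0_norm ?sg0//; exact: (cap_le_fine tau_stop).
Qed.

Lemma cap_sqr_cvg : \int[P]_w (sg K w ^+ 2) @[K --> \oo] --> \int[P]_w (tr w ^+ 2).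
Proof.
have [] := @dominated_real _ _ _ P N (fun K w => sg K w ^+ 2) (fun w => tr w ^+ 2)
  (fun w => tr w ^+ 2) => //.
- by move=> K; exact: measurable_funX.
- exact: measurable_funX.
- by move=> w Nw; exact: (@cap_cvg (fun x => x ^+ 2)).
- exact: tr_sq.2.
- move=> K w Nw; rewrite ger0_norm ?sqr_ge0//.
  by rewrite lerXn2r ?nnegrE ?sg0//; exact: (cap_le_fine tau_stop).
Qed.

Variables (b M : R).

(* By optional stopping this is [E (S sigma - M)^2] at the capped time [sigma]. *)
Definition overshoot (K : nat) : R :=
  \int[P]_w ((X K.+1%:R w + b * sg K w - M) ^+ 2 - v * (K.+1%:R - sg K w)).

(** Expanding the square, [E (sigma * X L)] is the expected area, [E (X L) = 0], and
    [E (X L ^ 2) = v * L] cancels the subtracted [v * L]. Nothing depends on [L] any more, so the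
    limit in [K] can be taken. *)
Lemma overshootE K : overshoot K =
  2 * b * \int[P]_w area (sg K w) w + b ^+ 2 * \int[P]_w (sg K w ^+ 2) -
  2 * b * M * \int[P]_w sg K w + M ^+ 2 + v * \int[P]_w sg K w.
Proof.
set L : R := K.+1%:R.
have XL_sq : square_integrable P (X L) by exact: (lbm_square_integrable HX).
have XL_int := square_integrable_integrable XL_sq.
have sg_int := square_integrable_integrable (sg_sq K).
have ia : P.-integrable setT (EFin \o (fun w => sg K w * X L w)).
  exact: square_integrableM.
have EX : \int[P]_w X L w = 0.
  have := @lbm_martingale _ _ _ _ _ _ _ HX 0 L (fun=> 1) (lexx 0) (ler0n _ _)
    (square_integrable_cst P 1).
  under eq_Rintegral do rewrite mul1r (lbm_start HX) subr0.
  by apply; exact: measurable_cst.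
have EX2 := lbm_sqr HX (ler0n R K.+1).
have -> : \int[P]_w area (sg K w) w = \int[P]_w (sg K w * X L w).
  have [_ h] := expectation_area HX (sg0 K) (sgK K) (sgO K).
  apply: EFin_inj; rewrite -h -Rintegral_EFin//.
    by apply: eq_integral => w _; rewrite areaE.
  have [+ _] := expectation_area HX (sg0 K) (sgK K) (sgO K).
  by congr integrable; apply/funext => w /=; rewrite areaE.
rewrite /overshoot.
transitivity (\int[P]_w (X L w ^+ 2 + (2 * b * (sg K w * X L w) +
   (b ^+ 2 * sg K w ^+ 2 + ((v - 2 * b * M) * sg K w +
   (- (2 * M) * X L w + (M ^+ 2 - v * L))))))).
  by apply: eq_Rintegral => w _; rewrite -/L; ring.
have i0 : P.-integrable setT (EFin \o (fun=> M ^+ 2 - v * L)) by exact: integrable_real_cst.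
have i1 := integrable_realZ (- (2 * M)) XL_int.
have i2 := integrable_realZ (v - 2 * b * M) sg_int.
have i3 := integrable_realZ (b ^+ 2) (sg_sq K).2.
have i4 := integrable_realZ (2 * b) ia.
have j1 := integrable_realD i1 i0.
have j2 := integrable_realD i2 j1.
have j3 := integrable_realD i3 j2.
have j4 := integrable_realD i4 j3.
rewrite RintegralD//; last exact: XL_sq.2.
rewrite RintegralD// RintegralD// RintegralD// RintegralD//.
rewrite !Rintegral_realZ//; last exact: (sg_sq K).2.
rewrite Rintegral_real_cst EX EX2 -/L; ring.
Qed.

Lemma overshoot_ge0 K : 0 <= overshoot K.
Proof. exact: (bounded_optional_lower HX (sg0 K) (sgK K) (sgO K)). Qed.

Lemma overshoot_cvg : overshoot K @[K --> \oo] -->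
  2 * b * \int[P]_w area (tr w) w + b ^+ 2 * \int[P]_w (tr w ^+ 2) -
  2 * b * M * \int[P]_w tr w + M ^+ 2 + v * \int[P]_w tr w.
Proof.
under eq_fun do rewrite overshootE.
have h1 := area_integrable_cvg.2; have h2 := cap_mean_cvg; have h3 := cap_sqr_cvg.
apply: cvgD; last exact: cvgMr.
apply: cvgD; last exact: cvg_cst.
apply: cvgB; last exact: cvgMr.
by apply: cvgD; exact: cvgMr.
Qed.

Theorem stopping_cost_lower : 0 <=
  2 * b * \int[P]_w area (tr w) w + b ^+ 2 * \int[P]_w (tr w ^+ 2) -
  2 * b * M * \int[P]_w tr w + M ^+ 2 + v * \int[P]_w tr w.
Proof.
rewrite -(cvg_lim _ overshoot_cvg)//; apply: limr_ge.
  by apply/cvg_ex; eexists; exact: overshoot_cvg.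
by apply: nearW => K; exact: overshoot_ge0.
Qed.

End second_moment.

End unbounded_stopping_time.

(** * Upper bound for times that stop on the line *)

Section hitting_upper.
Context (R : realType) (d : measure_display) (T : measurableType d).
Variable P : probability T R.
Variables (G : R -> set (set T)) (X : R -> T -> R) (v : R).
Hypothesis HX : linear_bracket_martingale P G X v.
Variable tau : T -> \bar R.
Hypothesis tau_stop : stopping_time G tau.
Variables (b M : R).
Hypothesis b_gt0 : 0 < b.
Hypothesis tau_hit : forall w, (tau w < +oo)%E ->
  X (fine (tau w)) w = M - b * fine (tau w).

Let sg := cap tau.
Let sg0 := cap_ge0 tau_stop.
Let sgK := cap_le tau_stop.
Let sgO := cap_optional HX tau_stop.
Let tr (w : T) : R := fine (tau w).
Let N := [set w | (tau w < +oo)%E].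
Let v0 := lbm_bracket_ge0 HX.
Let tr0 w : 0 <= tr w. Proof. by rewrite fine_ge0// tau_stop.1. Qed.
Let mtr : measurable_fun setT tr := fine_tau_measurable HX tau_stop.
Let mN : measurable N := finite_time_measurable HX tau_stop.
Let A (k : nat) := [set w | (k%:R%:E <= tau w)%E].

Hypothesis N1 : P (~` N) = 0%E.
Hypothesis tr_int : P.-integrable setT (EFin \o tr).

Let AE k m w : (k <= m)%N -> (k%:R <= sg m w) <-> A k w.
Proof.
move=> km; rewrite -lee_fin (cap_fin tau_stop) le_min lee_fin ler_nat km andbT.
by split.
Qed.

Let sgE m w : A m w -> sg m w = m%:R.
Proof.
by move=> Am; apply/eqP; rewrite eq_le sgK; apply/(AE w (leqnn m)).
Qed.

Let mA k : measurable (A k).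
Proof.
have := lbm_measurable HX (optional_time_ge HX (sgO k) k%:R).
by congr measurable; apply/seteqP; split=> w /(AE w (leqnn k)).
Qed.

(** [after_bracket_le] for growing caps, with Fatou; on [N] the capped value eventually becomes
    [M - b * tau]. The case [k = 0] yields the second moment, the case [k = K] controls the paths
    that the cap [K] interrupts. *)
Lemma hitting_tail k :
  P.-integrable setT
    (EFin \o (fun w => \1_N w * (\1_(A k) w * (M - b * tr w - X k%:R w) ^+ 2))) /\
  \int[P]_w (\1_N w * (\1_(A k) w * (M - b * tr w - X k%:R w) ^+ 2)) <=
  v * \int[P]_w (\1_(A k) w * (tr w + 1)).
Proof.
(* The shift by [k] keeps the cap at least [k], so that [k <= sg (m + k)] is the event [A k] for all
   [m]. *)
pose f m w : R := \1_(A k) w * (X (sg (m + k) w) w - X k%:R w) ^+ 2.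
have setE m : [set w | k%:R <= sg (m + k) w] = A k.
  by apply/seteqP; split=> w /(AE w (leq_addl m k)).
have fi m : P.-integrable setT (EFin \o f m) /\
    \int[P]_w f m w <= v * \int[P]_w (\1_(A k) w * (tr w + 1)).
  have := after_bracket_le HX (sg0 (m + k)) (sgK (m + k)) (sgO (m + k)) (leq_addl m k).
  rewrite setE => -[i1 i2]; split=> //; apply: le_trans i2 _.
  have sgi := square_integrable_integrable
    (sigma_square_integrable HX (sg0 (m + k)) (sgK (m + k)) (sgO (m + k))).
  apply: ler_wpM2l => //; apply: (le_Rintegral_on mN N1).
  - apply: integrable_real_indic => //; apply: integrable_realB.
      by apply: integrable_realD => //; exact: integrable_real_cst.
    exact: integrable_real_cst.
  - apply: integrable_real_indic => //.
    by apply: integrable_realD => //; exact: integrable_real_cst.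
  move=> w Nw; rewrite ler_wpM2l//.
  apply: (@le_trans _ _ (sg (m + k) w + 1)); first by rewrite lerBlDr lerDl.
  by rewrite lerD2r; exact: (cap_le_fine tau_stop).
apply: (@fatou_real _ _ _ P (fun m w => \1_N w * f m w)).
- move=> m w; apply: mulr_ge0 => //; apply: mulr_ge0 => //; exact: sqr_ge0.
- move=> w; have [Nw|Nw] := pselect (N w); last first.
    under eq_fun do rewrite indicE memNset// mul0r.
    rewrite indicE memNset// mul0r; exact: cvg_cst.
  apply: cvgMr; apply: cvgMr; rewrite -tau_hit//.
  have h := @cap_cvg _ _ _ _ _ tau_stop (fun s => (X s w - X k%:R w) ^+ 2) w Nw.
  by move: h; rewrite -(@cvg_shiftn k).
- by move=> m; apply: integrable_real_indic => //; exact: (fi m).1.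
- move=> m; apply: le_trans (fi m).2; apply: le_Rintegral => //.
  + by apply: integrable_real_indic => //; exact: (fi m).1.
  + exact: (fi m).1.
  + move=> w _; apply: ler_piMl; last by rewrite indicE lern1 leq_b1.
    by apply: mulr_ge0 => //; exact: sqr_ge0.
Qed.

(** [hitting_tail 0] says that [M - b * tau] is square integrable, as [X] starts at 0. The factor
    [2 / b ^ 2] comes from [(b * t) ^ 2 <= 2 * (M - b * t) ^ 2 + 2 * M ^ 2], that is, from
    [0 <= (2 * M - b * t) ^ 2]. *)
Lemma hitting_square_integrable : square_integrable P tr.
Proof.
split=> //; have [i0 _] := hitting_tail 0.
apply: (@le_integrable_real _ _ _ P _ (fun w => 2 / b ^+ 2 *
  (\1_N w * (\1_(A 0) w * (M - b * tr w - X 0%:R w) ^+ 2) + M ^+ 2))).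
- exact: measurable_funX.
- move=> w; rewrite ger0_norm ?sqr_ge0//.
  have b2 : 0 < b ^+ 2 by exact: exprn_gt0.
  have [Nw|Nw] := pselect (N w); last first.
    have -> : tr w = 0.
      by rewrite /tr; move: Nw; rewrite /N /=; case: (tau w) => [r|//|//]; rewrite ltry.
    rewrite expr0n/=; apply: mulr_ge0; first by rewrite divr_ge0// ltW.
    apply: addr_ge0; last exact: sqr_ge0.
    by apply: mulr_ge0 => //; apply: mulr_ge0 => //; exact: sqr_ge0.
  have A0 : A 0 w by exact: tau_stop.1.
  rewrite !indicE !mem_set// !mul1r (lbm_start HX) subr0.
  rewrite -mulrA mulrCA ler_pdivlMl//.
  by have := sqr_ge0 (2 * M - b * tr w); nra.
- apply: integrable_realZ; apply: integrable_realD => //.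
  exact: integrable_real_cst.
Qed.

Let tr_sq := hitting_square_integrable.

(** On [A K] the square in [overshoot] is at most [2 * (X L - X K) ^ 2 + 4 * (M - b * tau - X K) ^ 2
    + 4 * b ^ 2 * tau ^ 2]. The first term has expectation [2 * v * P (A K)], since [L - K = 1]; the
    second is bounded by [4 * v * (tau + 1)] integrated over [A K]. *)
Let bound K w : R := \1_(A K) w * (6 * v + 4 * v * tr w + 4 * b ^+ 2 * tr w ^+ 2).

Let g_int : P.-integrable setT
  (EFin \o (fun w => 6 * v + 4 * v * tr w + 4 * b ^+ 2 * tr w ^+ 2)).
Proof.
apply: integrable_realD; last by apply: integrable_realZ; exact: tr_sq.2.
apply: integrable_realD; [exact: integrable_real_cst|exact: integrable_realZ].
Qed.

(** Off [A K] the cap equals [tau] and the path is on the line, so the integrand is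
    [(X L - X sigma) ^ 2 - v * (L - sigma)], whose contribution is non-positive by
    [before_bracket_le]. Only the interrupted paths remain, and [hitting_tail] bounds them. *)
Lemma overshoot_le K : overshoot P X v tau b M K <= \int[P]_w bound K w.
Proof.
set L : R := K.+1%:R.
have KL : K%:R <= L by rewrite ler_nat.
have XL_sq : square_integrable P (X L) by exact: (lbm_square_integrable HX).
have XK_sq : square_integrable P (X K%:R) by exact: (lbm_square_integrable HX).
have sgs := sigma_square_integrable HX (sg0 K) (sgK K) (sgO K).
have sgi := square_integrable_integrable sgs.
pose C := [set w | sg K w < K%:R].
have mC : measurable C := lbm_measurable HX (sgO K K%:R).
have CA w : C w <-> ~ A K w.
  split=> [Cw /sgE e|nA]; first by move: Cw; rewrite /C /= e ltxx.
  by rewrite /C /= ltNge; apply/negP => /(AE w (leqnn K)).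
have [iC leC] := before_bracket_le HX (sg0 K) (sgK K) (sgO K) (leqnn K).
have GA : G K%:R (A K).
  have := optional_time_ge HX (sgO K) K%:R.
  by congr (G _ _); apply/seteqP; split=> w /(AE w (leqnn K)).
have eA := lbm_bracket HX (ler0n _ K) KL GA.
have [iH leH] := hitting_tail K.
have iLC : P.-integrable setT (EFin \o (fun w => \1_C w * (L - sg K w))).
  by apply: integrable_real_indic => //; apply: integrable_realB => //;
    exact: integrable_real_cst.
have iD : P.-integrable setT (EFin \o (fun w => \1_(A K) w * (X L w - X K%:R w) ^+ 2)).
  by apply: integrable_real_indic => //; exact: (square_integrableB XL_sq XK_sq).2.
have iT : P.-integrable setT (EFin \o (fun w => \1_(A K) w * tr w ^+ 2)).
  by apply: integrable_real_indic => //; exact: tr_sq.2.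
have i1 : P.-integrable setT (EFin \o (\1_(A K) : T -> R)) by exact: integrable_indic.
have iTr : P.-integrable setT (EFin \o (fun w => \1_(A K) w * (tr w + 1))).
  by apply: integrable_real_indic => //; apply: integrable_realD => //;
    exact: integrable_real_cst.
have j1 := integrable_realB iC (integrable_realZ v iLC).
have j2 := integrable_realZ 2 iD.
have j3 := integrable_realZ 4 iH.
have j4 := integrable_realZ (4 * b ^+ 2) iT.
have k1 := integrable_realD j3 j4.
have k2 := integrable_realD j2 k1.
have k3 := integrable_realD j1 k2.
apply: (@le_trans _ _ (\int[P]_w (
  (\1_C w * (X L w - X (sg K w) w) ^+ 2 - v * (\1_C w * (L - sg K w))) +
  (2 * (\1_(A K) w * (X L w - X K%:R w) ^+ 2) +
  (4 * (\1_N w * (\1_(A K) w * (M - b * tr w - X K%:R w) ^+ 2)) +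
   4 * b ^+ 2 * (\1_(A K) w * tr w ^+ 2)))))).
  apply: (le_Rintegral_on mN N1) => //.
    apply: integrable_realB.
      apply: (square_integrableB _ (square_integrable_cst P M)).2.
      by apply: square_integrableD => //; exact: square_integrableZ.
    apply: integrable_realZ; apply: integrable_realB => //; exact: integrable_real_cst.
  move=> w Nw; rewrite -/L -/(sg K w) [\1_N w]indicE mem_set// mul1r.
  have [Aw|nAw] := pselect (A K w).
    have nC : ~ C w by move=> /CA.
    rewrite !indicE (mem_set Aw) (memNset nC) !mul1r !mul0r mulr0 subr0 add0r.
    have e := sgE Aw; rewrite e.
    have Kt : K%:R <= tr w by rewrite -e; exact: (cap_le_fine tau_stop).
    have vL : 0 <= v * (L - K%:R) by rewrite mulr_ge0// subr_ge0.
    have b2 : b ^+ 2 * (tr w - K%:R) ^+ 2 <= b ^+ 2 * tr w ^+ 2.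
      apply: ler_wpM2l; first exact: sqr_ge0.
      by rewrite lerXn2r ?nnegrE ?subr_ge0//; have : 0 <= K%:R :> R by []; lra.
    set p := X L w - X K%:R w; set q := M - b * tr w - X K%:R w.
    have -> : X L w + b * K%:R - M = p - (q + b * (tr w - K%:R)).
      by rewrite /p /q; ring.
    have h1 := sqr_ge0 (p + (q + b * (tr w - K%:R))).
    have h2 := sqr_ge0 (q - b * (tr w - K%:R)).
    by nra.
  have Cw : C w by apply/CA.
  rewrite !indicE (memNset nAw) (mem_set Cw) !mul1r !mul0r !mulr0 !addr0.
  have e : sg K w = tr w.
    apply: (cap_fine tau_stop) => //; rewrite leNgt; apply/negP => lt; apply: nAw.
    rewrite /A /= -(@fineK _ (tau w)) ?lee_fin ?ltW//.
    by rewrite ge0_fin_numE ?tau_stop.1.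
  have -> : X (sg K w) w = M - b * sg K w by rewrite e; exact: tau_hit.
  by have -> : X L w - (M - b * sg K w) = X L w + b * sg K w - M by ring.
rewrite (RintegralD measurableT j1 k2) (RintegralD measurableT j2 k1).
rewrite (RintegralD measurableT j3 j4).
rewrite (RintegralB measurableT iC (integrable_realZ v iLC)).
rewrite !Rintegral_realZ// eA.
have Lk : L - K%:R = 1 by rewrite /L -natr1 addrAC subrr add0r.
rewrite Lk mulr1.
have eb : \int[P]_w bound K w = 2 * v * \int[P]_w \1_(A K) w +
   4 * v * \int[P]_w (\1_(A K) w * (tr w + 1)) +
   4 * b ^+ 2 * \int[P]_w (\1_(A K) w * tr w ^+ 2).
  have m1 := integrable_realZ (2 * v) i1.
  have m2 := integrable_realZ (4 * v) iTr.
  have m3 := integrable_realZ (4 * b ^+ 2) iT.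
  rewrite -(Rintegral_realZ (2 * v) i1) -(Rintegral_realZ (4 * v) iTr).
  rewrite -(Rintegral_realZ (4 * b ^+ 2) iT) -(RintegralD measurableT m1 m2).
  rewrite -(RintegralD measurableT (integrable_realD m1 m2) m3).
  by apply: eq_Rintegral => w _; rewrite /bound; ring.
rewrite eb; move: leC leH.
set a1 := \int[P]_w _; set a2 := \int[P]_w _; set a3 := \int[P]_w _.
by move=> leC leH; lra.
Qed.

(** As [K] grows, the [overshoot] tends to the left side, while [bound K] tends to 0 on [N],
    dominated thanks to the second moment. *)
Theorem stopping_cost_upper :
  2 * b * \int[P]_w area X (tr w) w + b ^+ 2 * \int[P]_w (tr w ^+ 2) -
  2 * b * M * \int[P]_w tr w + M ^+ 2 + v * \int[P]_w tr w <= 0.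
Proof.
have ocv := @overshoot_cvg _ _ _ _ _ _ _ HX _ tau_stop N1 tr_sq b M.
have [_ bcv] : P.-integrable setT (EFin \o (fun=> 0 : R)) /\
    \int[P]_w bound K w @[K --> \oo] --> \int[P]_w (fun=> 0 : R) w.
  apply: (@dominated_real _ _ _ P N _ _
    (fun w => 6 * v + 4 * v * tr w + 4 * b ^+ 2 * tr w ^+ 2)) => //.
  - move=> K; apply: measurable_funM; first exact: measurable_indic.
    exact: integrable_real_measurable g_int.
  - move=> w Nw; apply: cvg_near_cst; near=> K.
    rewrite /bound indicE memNset ?mul0r// /A /=.
    apply/negP; rewrite -ltNge -(@fineK _ (tau w)) ?lte_fin; last first.
      by rewrite ge0_fin_numE ?tau_stop.1.
    near: K; exists (Num.truncn (tr w)).+1 => // k /= mk.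
    by apply: lt_le_trans (truncnS_gt (tr w)) _; rewrite ler_nat.
  - move=> K w Nw; rewrite /bound normrM ger0_norm//.
    have g0 : 0 <= 6 * v + 4 * v * tr w + 4 * b ^+ 2 * tr w ^+ 2.
      apply: addr_ge0; first by apply: addr_ge0; rewrite !mulr_ge0.
      by apply: mulr_ge0; [apply: mulr_ge0 => //; exact: sqr_ge0|exact: sqr_ge0].
    by rewrite ger0_norm// ler_piMl// indicE lern1 leq_b1.
rewrite Rintegral_real_cst in bcv.
apply: (ler_cvg_to ocv bcv); apply: nearW => K; exact: overshoot_le.
Unshelve. all: by end_near. Qed.

End hitting_upper.

(** * Hitting times *)

Section hitting_time.
Context (R : realType) (d : measure_display) (T : measurableType d).
Variables (S : R -> T -> R) (M : R).
Hypothesis cS : forall w, {within `[0, +oo[, continuous (S ^~ w)}.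
Hypothesis S0 : forall w, S 0 w < M.

(** Abstracts [irp_cycle] over the weighted demand [S]; the two are convertible, so the results
    below apply to the policy directly. *)
Definition hitting_time (w : T) : \bar R :=
  ereal_inf (EFin @` [set t : R | 0 < t /\ M <= S t w]).

Lemma hitting_time_ge0 w : (0 <= hitting_time w)%E.
Proof.
by apply: le_ereal_inf_tmp => _ [t [t0 _] <-]; rewrite lee_fin ltW.
Qed.

Lemma hitting_time_le t w : 0 < t -> M <= S t w -> (hitting_time w <= t%:E)%E.
Proof. by move=> t0 Mt; apply: ereal_inf_lbound; exists t. Qed.

Let S_cvg (w : T) (u : nat -> R) (x : R) : (forall n, 0 <= u n) -> 0 <= x ->
  u n @[n --> \oo] --> x -> S (u n) w @[n --> \oo] --> S x w.
Proof. by move=> u0 x0 ux; exact: (@within_nonneg_cvg _ (S ^~ w) _ _ (@cS w)). Qed.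

Let fin_hit w : (hitting_time w < +oo)%E ->
  hitting_time w = (fine (hitting_time w))%:E.
Proof. by move=> h; rewrite fineK// ge0_fin_numE ?hitting_time_ge0. Qed.

Let hit_ge0 w : 0 <= fine (hitting_time w).
Proof. by rewrite fine_ge0// hitting_time_ge0. Qed.

Lemma hitting_time_reached w : (hitting_time w < +oo)%E ->
  M <= S (fine (hitting_time w)) w.
Proof.
move=> /fin_hit; set r := fine _ => hr.
have r0 : 0 <= r := hit_ge0 w.
have /choice[u hu] : forall n : nat, exists t : R,
    [/\ 0 < t, M <= S t w, r <= t & t <= r + harmonic n].
  move=> n; have : (hitting_time w < (r + harmonic n)%:E)%E.
    by rewrite hr lte_fin ltrDl harmonic_gt0.
  move=> /ereal_inf_lt[_ [t [t0 Mt] <-]]; rewrite lte_fin => /ltW tr.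
  by exists t; split=> //; rewrite -lee_fin -hr; exact: hitting_time_le.
have ur : u n @[n --> \oo] --> r.
  apply: (@squeeze_cvgr _ _ _ _ (fun=> r) (fun n => r + harmonic n)).
  - by apply: nearW => n; have [_ _ -> ->] := hu n.
  - exact: cvg_cst.
  - by rewrite -[X in _ --> X]addr0; apply: cvgD; [exact: cvg_cst|exact: cvg_harmonic].
have u0 n : 0 <= u n by have [/ltW] := hu n.
have h := @S_cvg w u r u0 r0 ur.
rewrite -(cvg_lim _ h)//; apply: limr_ge; first by apply/cvg_ex; exists (S r w).
by apply: nearW => n; have [] := hu n.
Qed.

Lemma hitting_time_gt0 w : (hitting_time w < +oo)%E -> 0 < fine (hitting_time w).
Proof.
move=> /hitting_time_reached h; rewrite lt_neqAle hit_ge0 andbT.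
apply/eqP => e; move: h; rewrite -e leNgt.
by rewrite S0.
Qed.

Lemma hitting_time_value w : (hitting_time w < +oo)%E ->
  S (fine (hitting_time w)) w = M.
Proof.
move=> fin; apply/eqP; rewrite eq_le hitting_time_reached// andbT.
have hr := fin_hit fin; have := hitting_time_gt0 fin.
set r := fine _ in hr * => r0.
(* Times approaching [r] from the left, where [M] is not yet reached. The shifted index gives
   [1 / (n + 2) < 1], which keeps [u n] positive, as the infimum runs over positive times. *)
pose u (n : nat) := r - r * harmonic n.+1.
have hu n : 0 < u n < r.
  have h1 : (harmonic n.+1 : R) < 1 by rewrite invf_lt1// ltr1n.
  have h0 : 0 < (harmonic n.+1 : R) by exact: harmonic_gt0.
  by rewrite /u; apply/andP; split; nra.
have u0 n : 0 <= u n by have /andP[/ltW] := hu n.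
have ur : u n @[n --> \oo] --> r.
  rewrite -[X in _ --> X]subr0; apply: cvgB; first exact: cvg_cst.
  rewrite -(mulr0 r); apply: cvgMr.
  by have := @cvg_harmonic R; rewrite -(@cvg_shiftS R (@harmonic R)).
have h := @S_cvg w u r u0 (ltW r0) ur.
rewrite -(cvg_lim _ h)//; apply: limr_le; first by apply/cvg_ex; exists (S r w).
apply: nearW => n; have /andP[un0 unr] := hu n.
rewrite leNgt; apply/negP => /ltW/(hitting_time_le un0).
by rewrite hr lee_fin leNgt unr.
Qed.

(** The right side uses countably many times in [[0, t]], so the event lies in [G t] itself, without
    right-continuity of the filtration. Forwards, the level [M] is attained by time [t] and
    continuity brings fractions of [t] above [M - 1 / (k + 1)]. Backwards, the maximum of the path
    over [[0, t]] is at least [M], and not at 0 because [S 0 w < M]. *)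
Lemma hitting_time_leP t w : 0 <= t ->
  (hitting_time w <= t%:E)%E <->
  forall k : nat, exists m i : nat,
    (i <= m.+1)%N /\ M - k.+1%:R^-1 < S (t * (i%:R / m.+1%:R)) w.
Proof.
move=> t0; split=> [ht k|h].
  have fin : (hitting_time w < +oo)%E by apply: le_lt_trans ht _; rewrite ltry.
  have r0 := hitting_time_gt0 fin; have hM := hitting_time_value fin.
  move: ht; rewrite (fin_hit fin) lee_fin; move: r0 hM; set r := fine _ => r0 hM rt.
  have tp : 0 < t by exact: lt_le_trans rt.
  have rt0 : 0 <= r / t by rewrite divr_ge0// ltW.
  (* Fractions of [t] just below [r <= t], so that [i m <= m.+1]. *)
  pose i m := Num.truncn (m.+1%:R * (r / t)).
  pose u (m : nat) := t * ((i m)%:R / m.+1%:R).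
  have u0 m : 0 <= u m by rewrite mulr_ge0// divr_ge0.
  have hu m : r - t * harmonic m <= u m <= r.
    have p0 : 0 <= m.+1%:R * (r / t) by rewrite mulr_ge0.
    have /andP[lo hi] := truncn_itv p0.
    have h1 : (i m)%:R / m.+1%:R <= r / t by rewrite ler_pdivrMr// mulrC.
    have h2 : r / t - harmonic m <= (i m)%:R / m.+1%:R.
      rewrite ler_pdivlMr// mulrBl [harmonic m * _]mulVf// lerBlDr natr1 mulrC.
      exact: ltW.
    have e : r = t * (r / t) by rewrite mulrCA divff ?mulr1// gt_eqF.
    rewrite {1 2}e -mulrBr /u; apply/andP.
    by split; apply: ler_wpM2l.
  have ur : u m @[m --> \oo] --> r.
    apply: (@squeeze_cvgr _ _ _ _ (fun m => r - t * harmonic m) (fun=> r)).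
    - exact: nearW.
    - rewrite -[X in _ --> X]subr0; apply: cvgB; first exact: cvg_cst.
      by rewrite -(mulr0 t); apply: cvgMr; exact: cvg_harmonic.
    - exact: cvg_cst.
  have := @S_cvg w u r u0 (ltW r0) ur; rewrite hM => hS.
  have Mk : M - k.+1%:R^-1 < M by rewrite ltrBlDr ltrDl invr_gt0.
  have := @cvgr_gt _ _ _ _ (fun n => S (u n) w) M hS _ Mk.
  move=> [m _ /(_ m (leqnn m)) hm]; exists m, (i m); split=> //.
  rewrite -(ler_nat R); have /andP[_ um] := hu m.
  have : (i m)%:R / m.+1%:R <= 1 :> R.
    by rewrite -(ler_pM2l tp) mulr1; exact: le_trans um rt.
  by rewrite ler_pdivrMr// mul1r.
have cst : {within `[0, t], continuous (S ^~ w)}.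
  apply: (@continuous_subspaceW _ _ _ _ (S ^~ w) _ (@cS w)).
  by move=> x /=; rewrite !in_itv/= => /andP[->].
have [c] := EVT_max t0 cst; rewrite in_itv/= => /andP[c0 ct] hc.
have Mc : M <= S c w.
  rewrite leNgt; apply/negP => /ltr_add_invr[k hk].
  have [m [i [im]]] := h k.
  apply/negP; rewrite -leNgt; apply: (@le_trans _ _ (S c w)).
    apply: hc; rewrite in_itv/= mulr_ge0 ?divr_ge0//= ler_piMr//.
    by rewrite ler_pdivrMr// mul1r ler_nat.
  by rewrite lerBrDr ltW.
have cp : 0 < c.
  by rewrite lt_neqAle c0 andbT; apply/eqP => e; move: Mc; rewrite -e leNgt S0.
by apply: le_trans (hitting_time_le cp Mc) _; rewrite lee_fin.
Qed.

Lemma hitting_time_stopping (G : R -> set (set T)) :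
  (forall t, sigma_algebra setT (G t)) ->
  (forall s t, s <= t -> G s `<=` G t) ->
  (forall t, 0 <= t -> measurable_wrt (G t) (S t)) ->
  stopping_time G hitting_time.
Proof.
move=> sG mG aG; split; first exact: hitting_time_ge0.
move=> t t0; have -> : [set w | (hitting_time w <= t%:E)%E] =
    \bigcap_k \bigcup_m \bigcup_i [set w | (i <= m.+1)%N /\
      M - k.+1%:R^-1 < S (t * (i%:R / m.+1%:R)) w].
  apply/seteqP; split=> w /=.
    move=> /(hitting_time_leP w t0) h k _; have [m [i im]] := h k.
    by exists m => //; exists i.
  move=> h; apply/(hitting_time_leP w t0) => k.
  by have [m _ [i _ im]] := h k I; exists m, i.
suff : @measurable _ (g_sigma_algebraType (G t)) (\bigcap_k \bigcup_m \bigcup_i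
    [set w | (i <= m.+1)%N /\ M - k.+1%:R^-1 < S (t * (i%:R / m.+1%:R)) w]).
  by rewrite measurable_g_measurableTypeE.
apply: bigcap_measurableType => k _.
apply: bigcupT_measurable => m; apply: bigcupT_measurable => i.
have [im|im] := boolP (i <= m.+1)%N; last first.
  rewrite [X in measurable X](_ : _ = set0); first exact: measurable0.
  by apply/seteqP; split=> // w [].
have q0 : 0 <= t * (i%:R / m.+1%:R) by rewrite mulr_ge0// divr_ge0.
have qt : t * (i%:R / m.+1%:R) <= t.
  by rewrite ler_piMr// ler_pdivrMr// mul1r ler_nat.
rewrite measurable_g_measurableTypeE//; apply: (mG _ _ qt).
have := measurable_wrt_preimage (aG _ q0) (measurable_itv `]M - k.+1%:R^-1, +oo[).
rewrite sigma_algebra_id//; congr (G _ _); apply/seteqP; split=> w /=;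
  by rewrite in_itv/= andbT// => -[].
Qed.

End hitting_time.

(** * Weighted demand *)

Section integral_id.
Context (R : realType).
Local Notation mu := (@lebesgue_measure R).

Lemma integral_itv0_id (s : R) : 0 <= s ->
  (\int[mu]_(u in `[0%R, s]) u%:E = (s ^+ 2 / 2)%:E)%E.
Proof.
rewrite le_eqVlt => /predU1P[<-|s0].
  by rewrite set_itv1 integral_set1 expr0n/= mul0r.
pose F (u : R) : R := u ^+ 2.
have F'E u : F^`()%classic u = 2 * u by rewrite /F exp_derive1 expr1.
have dF u : derivable (F : R -> R^o) u 1 by exact: exprn_derivable.
have cF u : F x @[x --> u] --> F u by exact: exprn_continuous.
have cf : {within `[0, s], continuous (fun u : R => 2 * u)}.
  by apply: continuous_subspaceT => u; apply: cvgMr; exact: cvg_id.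
have h := @continuous_FTC2 R (fun u => 2 * u) F 0 s s0 cf.
transitivity (\int[mu]_(u in `[0%R, s]) (2^-1%:E * (2 * u)%:E))%E.
  by apply: eq_integral => u _; rewrite -EFinM mulrA mulVf// mul1r.
rewrite integralZl//; last first.
  by apply: continuous_compact_integrable => //; exact: segment_compact.
rewrite h => [||u _]; last exact: F'E.
  by rewrite -EFinB -EFinM /F expr0n/= subr0 mulrC.
split=> [u _||]; first exact: dF.
  by apply: cvg_at_right_filter; exact: cF.
by apply: cvg_at_left_filter; exact: cF.
Qed.

End integral_id.

Section finite_mean.
Context (R : realType) (d : measure_display) (T : measurableType d).
Variable P : probability T R.

Lemma integrable_fine (f : T -> \bar R) : measurable_fun setT f ->
  (forall w, (0 <= f w)%E) -> (\int[P]_w f w < +oo)%E ->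
  [/\ P (~` [set w | (f w < +oo)%E]) = 0%E,
      P.-integrable setT (EFin \o (fun w => fine (f w))) &
      (\int[P]_w f w = (\int[P]_w fine (f w))%:E)%E].
Proof.
move=> mf f0 foo.
have fi : P.-integrable setT f.
  apply/integrableP; split=> //.
  by under eq_integral do rewrite gee0_abs//.
have fE w : (f w < +oo)%E -> (fine (f w))%:E = f w.
  by move=> foo'; rewrite fineK// ge0_fin_numE.
have mN : measurable [set w | (f w < +oo)%E].
  have := emeasurable_fun_infty_o measurableT mf +oo%E.
  by rewrite setTI; apply.
have mfine : measurable_fun setT (fun w => fine (f w)) by exact: measurableT_comp.
have ae0 := integrable_ae measurableT fi.
have N0 : P (~` [set w | (f w < +oo)%E]) = 0%E.
  apply/(@negligibleP _ _ _ P); first exact: measurableC.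
  apply: negligibleS ae0 => w /= nf h; apply: nf.
  by rewrite -ge0_fin_numE//; exact: h.
have eqI : (\int[P]_w f w = \int[P]_w (fine (f w))%:E)%E.
  apply: ae_eq_integral => //; first exact/measurable_EFinP.
  by apply: filterS ae0 => w h _; rewrite fineK//; exact: h.
have fini : P.-integrable setT (EFin \o (fun w => fine (f w))).
  apply/integrableP; split; first exact/measurable_EFinP.
  under eq_integral do rewrite /= ger0_norm ?fine_ge0//.
  by rewrite -eqI.
by split=> //; rewrite eqI Rintegral_EFin.
Qed.

End finite_mean.

Section weighted_demand.
Context (R : realType) (d : measure_display) (T : measurableType d).
Variables (P : probability T R) (n : nat) (B : 'I_n -> R -> {RV P >-> R}).
Hypothesis B_brownian : forall i : 'I_n, standard_brownian_motion (B i).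
Hypothesis B_indep : independent_processes B.
Variables D sigma omega : 'I_n -> R.
Hypothesis sigma_gt0 : forall i : 'I_n, 0 < sigma i.
Local Notation mu := (@lebesgue_measure R).

Let G := natural_filtration (demand D sigma B).
Let X := combination B (fun i => omega i * sigma i).
Let b := \sum_i omega i * D i.
Let v := combination_variance (fun i => omega i * sigma i).
Let S (t : R) (w : T) : R := \sum_i omega i * demand D sigma B i t w.

Lemma weighted_demandE t w : S t w = b * t + X t w.
Proof.
rewrite /S /b /X /combination mulr_suml -big_split/=; apply: eq_bigr => i _.
by rewrite /demand mulrDr !mulrA.
Qed.

Lemma demand_measurable i t : measurable_fun setT (demand D sigma B i t).
Proof.
by apply: measurable_funD => //; apply: measurable_funM.
Qed.

Lemma demand_continuous i w :
  {within `[0, +oo[, continuous (fun t => demand D sigma B i t w)}.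
Proof.
have cB : {within `[0, +oo[, continuous (fun t => B i t w)}.
  exact: (sbm_continuous (B_brownian i)).
have cid : {within `[0, +oo[, continuous (fun t : R => t)}.
  by apply: continuous_subspaceT => u; exact: cvg_id.
by move=> x; apply: cvgD; apply: cvgMr; [exact: cid|exact: cB].
Qed.

Lemma within_continuous_sum (I : Type) (s : seq I) (A : set R) (f : I -> R -> R) :
  (forall i, {within A, continuous (f i)}) ->
  {within A, continuous (fun t => \sum_(i <- s) f i t)}.
Proof.
move=> cf; elim: s => [|i s ih].
  by under eq_fun do rewrite big_nil; move=> x; exact: cvg_cst.
under eq_fun do rewrite big_cons; move=> x; apply: cvgD; [exact: cf|exact: ih].
Qed.

Lemma weighted_demand_continuous w : {within `[0, +oo[, continuous (S ^~ w)}.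
Proof.
apply: within_continuous_sum => i x; apply: cvgMr; exact: demand_continuous.
Qed.

Lemma demand_adapted i t : 0 <= t -> measurable_wrt (G t) (demand D sigma B i t).
Proof.
move=> t0; apply: measurable_wrtP => A mA; apply: sub_sigma_algebra.
have := @sigma_generated_gen _ _ _ _ (fun p : 'I_n * R => demand D sigma B p.1 p.2)
  [set p | 0 <= p.2 <= t] (i, t) A.
by apply=> //=; rewrite t0 lexx.
Qed.

Lemma weighted_demand_adapted t : 0 <= t -> measurable_wrt (G t) (S t).
Proof.
move=> t0; rewrite /measurable_wrt /S.
elim: (index_enum _) => [|i s ih].
  by under eq_fun do rewrite big_nil; exact: measurable_cst.
under eq_fun do rewrite big_cons; apply: measurable_funD => //.
by apply: measurable_funM => //; exact: demand_adapted.
Qed.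

Lemma demand_filtration_sigma_algebra t : sigma_algebra setT (G t).
Proof. exact: sigma_generated_sigma_algebra. Qed.

Lemma demand_filtration_le s t : s <= t -> G s `<=` G t.
Proof.
move=> st; apply: sub_sigma_algebra2; apply: bigcup_subset => p /= /andP[p0 ps].
by rewrite p0 (le_trans ps st).
Qed.

(** The observed past stops all components at [s], whereas a box for [j] stops [B j] alone; hence
    the inclusion holds for every [j]. *)
Lemma demand_filtration_past j s : 0 <= s -> G s `<=` <<s past_box B j s >>.
Proof.
move=> s0; apply: sigma_generated_sub; first exact: smallest_sigma_algebra.
move=> [i u] A /= /andP[u0 us] mA.
have mB : measurable_wrt (past_box B j s) (B i u) by exact: past_box_component.
apply: (measurable_wrt_preimage _ mA).
apply: (@measurable_funD _ (g_sigma_algebraType (past_box B j s))) => //.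
exact: (@measurable_funM _ (g_sigma_algebraType (past_box B j s))).
Qed.

Lemma weighted_noise_martingale : linear_bracket_martingale P G X v.
Proof.
have X_sq t : 0 <= t -> square_integrable P (X t).
  move=> t0; have := combination_increment_square_integrable B_brownian
    (fun i => omega i * sigma i) (lexx 0) t0.
  congr square_integrable; apply/funext => w; rewrite /combination.
  rewrite [X in _ - X]big1 ?subr0// => i _.
  by rewrite (sbm_start (B_brownian i)) mulr0.
split.
- exact: demand_filtration_sigma_algebra.
- exact: demand_filtration_le.
- move=> t; apply: sigma_generated_sub; first exact: sigma_algebra_measurable.
  move=> [i u] A _ mA; rewrite -[X in measurable X]setTI.
  exact: demand_measurable.
- move=> w; rewrite /X /combination big1// => i _.
  by rewrite (sbm_start (B_brownian i)) mulr0.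
- move=> w; apply: within_continuous_sum => i x; apply: cvgMr.
  exact: (sbm_continuous (B_brownian i)).
(* The filtration is generated by the demands, not by the noise; subtracting the deterministic drift
   from the observed [S] recovers [X]. *)
- move=> t t0; have -> : X t = (fun w => S t w - b * t).
    by apply/funext => w; rewrite weighted_demandE; ring.
  apply: (@measurable_funB _ (g_sigma_algebraType (G t))) => //.
  exact: weighted_demand_adapted.
- exact: X_sq.
- exact: combination_variance_ge0.
- by move=> s t U s0 st;
    apply: (combination_martingale B_brownian B_indep _ demand_filtration_past).
- by move=> s t A s0 st;
    apply: (combination_quadratic B_brownian B_indep _ demand_filtration_past).
Qed.

Let HX := weighted_noise_martingale.

(** Where [tau] is finite, the weighted sum under the integral is [b * u + X u], and the drift
    integrates to [b * tau ^ 2 / 2]. Where it is infinite the integrals run over a half-line, hence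
    an almost everywhere argument. *)
Lemma expected_cost (tau : T -> \bar R) : stopping_time G tau ->
  P (~` [set w | (tau w < +oo)%E]) = 0%E ->
  square_integrable P (fun w => fine (tau w)) ->
  (\int[P]_w \sum_(i : 'I_n)
    \int[mu]_(u in [set u : R | (0 <= u)%R /\ u%:E <= tau w])
      (omega i * demand D sigma B i u w)%:E =
   (b / 2 * \int[P]_w (fine (tau w) ^+ 2) +
     \int[P]_w area X (fine (tau w)) w)%:E)%E.
Proof.
move=> tau_stop N1 tr_sq.
have mtau := stopping_time_measurable HX tau_stop.
have mN := finite_time_measurable HX tau_stop.
have [ia _] := area_integrable_cvg HX tau_stop N1 tr_sq.
have iq := integrable_realZ (b / 2) tr_sq.2.
have ij := integrable_realD iq ia.
rewrite -Rintegral_realZ; last exact: tr_sq.2.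
rewrite -RintegralD// -Rintegral_EFin//.
have mY i t : measurable_fun setT (fun w => omega i * demand D sigma B i t w).
  by apply: measurable_funM => //; exact: demand_measurable.
have cY i w :
    {within `[0, +oo[, continuous (fun t => omega i * demand D sigma B i t w)}.
  by move=> x; apply: cvgMr; exact: demand_continuous.
apply: ae_eq_integral => //.
- apply: emeasurable_sum => i.
  exact: (@measurable_area _ _ T (fun t w => omega i * demand D sigma B i t w)
    (fun t _ => mY i t) (cY i) _ mtau).
- exact: measurable_int ij.
exists (~` [set w | (tau w < +oo)%E]); split=> //; first exact: measurableC.
move=> w /= nh Nw; apply: nh => _.
have tw : tau w = (fine (tau w))%:E.
  by rewrite fineK// ge0_fin_numE ?tau_stop.1.
have r0 : 0 <= fine (tau w) by rewrite fine_ge0// tau_stop.1.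
move: tw r0; set r := fine _ => -> r0.
rewrite area_set -integral_sum//; last first.
  move=> i; exact: (@path_integrable _ _ T
    (fun t w => omega i * demand D sigma B i t w) (cY i)).
have iX := @path_integrable _ _ T X (@lbm_continuous _ _ _ _ _ _ _ HX) w r.
have iid : mu.-integrable `[0, r] (fun u : R => (b * u)%:E).
  apply: continuous_compact_integrable; first exact: segment_compact.
  by apply: continuous_subspaceT => u; apply: cvgMr; exact: cvg_id.
have iid1 : mu.-integrable `[0, r] (EFin : R -> \bar R).
  apply: (@continuous_compact_integrable _ (fun u : R => u)); first exact: segment_compact.
  by apply: continuous_subspaceT => u; exact: cvg_id.
transitivity (\int[mu]_(u in `[0%R, r]) ((b * u)%:E + (X u w)%:E))%E.
  by apply: eq_integral => u _; rewrite sumEFin -EFinD -weighted_demandE.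
rewrite /= integralD// EFinD; congr (_ + _)%E; last exact: (areaE HX).
under eq_integral do rewrite EFinM.
rewrite integralZl// integral_itv0_id// -EFinM; congr EFin.
by rewrite mulrCA mulrC mulrA.
Qed.

End weighted_demand.

(** [k], [p] and [z] stand for [2 * b * M * E tau], [M ^ 2] and [v * E tau], the same for both
    policies; what remains is [2 * b] times each cost. *)
Lemma cost_le (R : realFieldType) (b q a q' a' k p z : R) : 0 < b ->
  0 <= 2 * b * a + b ^+ 2 * q - k + p + z ->
  2 * b * a' + b ^+ 2 * q' - k + p + z <= 0 ->
  b / 2 * q' + a' <= b / 2 * q + a.
Proof.
move=> b0 lower upper; rewrite -(ler_pM2l (mulr_gt0 (ltr0Sn R 1) b0)).
have e x y : 2 * b * (b / 2 * x + y) = 2 * b * y + b ^+ 2 * x by field.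
by rewrite !e; lra.
Qed.

Theorem theorem24 (R : realType) (d : measure_display) (T : measurableType d)
    (P : probability T R) (n : nat) (n_ge1 : (1 <= n)%N)
    (B : 'I_n -> R -> {RV P >-> R})
    (B_brownian : forall i : 'I_n, standard_brownian_motion (B i))
    (B_indep : independent_processes B)
    (D sigma omega : 'I_n -> R)
    (D_gt0 : forall i : 'I_n, 0 < D i)
    (sigma_gt0 : forall i : 'I_n, 0 < sigma i)
    (omega_gt0 : forall i : 'I_n, 0 < omega i)
    (tau : T -> \bar R)
    (tau_stop : stopping_time (natural_filtration (demand D sigma B)) tau)
    (tau_mean_gt0 : (0 < \int[P]_w tau w)%E)
    (tau_second_moment : (\int[P]_w (tau w ^+ 2) < +oo)%E)
    (M : R) (M_gt0 : 0 < M)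
    (same_frequency :
      (\int[P]_w irp_cycle omega (demand D sigma B) M w = \int[P]_w tau w)%E) :
  (AWDR P omega (demand D sigma B) (irp_cycle omega (demand D sigma B) M)
   <= AWDR P omega (demand D sigma B) tau)%E.
Proof.
have HX := @weighted_noise_martingale _ _ _ _ _ _ B_brownian B_indep D sigma omega.
set X := combination _ _ in HX; set v := combination_variance _ in HX.
set b := \sum_i omega i * D i.
have b0 : 0 < b.
  rewrite /b (bigD1 (Ordinal n_ge1))//= ltr_pwDl ?mulr_gt0//.
  by apply: sumr_ge0 => i _; rewrite mulr_ge0// ltW.
set tauM := irp_cycle omega (demand D sigma B) M in same_frequency *.
pose S (t : R) (w : T) : R := \sum_i omega i * demand D sigma B i t w.
have SE t w : S t w = b * t + X t w by exact: weighted_demandE.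
have cS w : {within `[0, +oo[, continuous (S ^~ w)}.
  exact: (weighted_demand_continuous B_brownian).
have S0 w : S 0 w < M by rewrite SE (lbm_start HX) mulr0 addr0.
have tauM_stop : stopping_time (natural_filtration (demand D sigma B)) tauM.
  apply: (@hitting_time_stopping _ _ T S M cS S0).
  - exact: demand_filtration_sigma_algebra.
  - exact: demand_filtration_le.
  - exact: weighted_demand_adapted.
have tauM_hit w : (tauM w < +oo)%E ->
    X (fine (tauM w)) w = M - b * fine (tauM w).
  move=> fin; rewrite -[M in RHS](@hitting_time_value _ _ T S M cS S0 w fin) SE.
  by rewrite addrAC subrr add0r.
have mtau := stopping_time_measurable HX tau_stop.
have mtauM := stopping_time_measurable HX tauM_stop.
have msq : measurable_fun setT (fun w => (tau w ^+ 2)%E).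
  by under eq_fun do rewrite expe2; exact: emeasurable_funM.
have sq_ge0 w : (0 <= tau w ^+ 2)%E by rewrite expe2 mule_ge0// tau_stop.1.
have [N2 i2 _] := integrable_fine msq sq_ge0 tau_second_moment.
(* At [+oo] both sides are 0, since [fine] sends [+oo] to 0. *)
have sqE w : fine (tau w ^+ 2)%E = fine (tau w) ^+ 2.
  rewrite expe2; have := tau_stop.1 w; case: (tau w) => [r _|_|//].
    by rewrite -EFinM/= expr2.
  by rewrite mulyy/= expr0n.
have NE : [set w | (tau w ^+ 2 < +oo)%E] = [set w | (tau w < +oo)%E].
  apply/seteqP; split=> w /=; have := tau_stop.1 w;
    case: (tau w) => [r _|_|//]; rewrite ?ltry -?EFin_expe ?ltry//.
rewrite NE in N2.
have tr_sq : square_integrable P (fun w => fine (tau w)).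
  split; first exact: measurableT_comp.
  by apply: eq_integrable i2 => //= w _; rewrite sqE.
have tr_int := square_integrable_integrable tr_sq.
have meanE : (\int[P]_w tau w = (\int[P]_w fine (tau w))%:E)%E.
  rewrite -Rintegral_EFin//; apply: ae_eq_integral => //.
    exact: measurable_int tr_int.
  exists (~` [set w | (tau w < +oo)%E]); split=> //.
    exact: measurableC (finite_time_measurable HX tau_stop).
  by move=> w /= nh Nw; apply: nh => _; rewrite fineK// ge0_fin_numE ?tau_stop.1.
(* The frequency constraint provides the finite mean of [tauM], hence its almost sure finiteness;
   the second moment then follows from [hitting_square_integrable]. *)
have meanM_lty : (\int[P]_w tauM w < +oo)%E.
  by rewrite same_frequency meanE ltry.
have [NM iM meanME] := integrable_fine mtauM tauM_stop.1 meanM_lty.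
have trM_sq := hitting_square_integrable HX tauM_stop b0 tauM_hit NM iM.
have lower := stopping_cost_lower HX tau_stop N2 tr_sq b M.
have upper := stopping_cost_upper HX tauM_stop b0 tauM_hit NM iM.
have mean_eq : \int[P]_w fine (tauM w) = \int[P]_w fine (tau w).
  by apply: EFin_inj; rewrite -meanME same_frequency meanE.
rewrite /AWDR same_frequency; apply: lee_wpmul2r.
  by rewrite inve_ge0 ltW.
rewrite (expected_cost B_brownian B_indep omega tau_stop N2 tr_sq).
rewrite (expected_cost B_brownian B_indep omega tauM_stop NM trM_sq).
rewrite lee_fin -/X -/b.
rewrite mean_eq in upper.
exact: (cost_le b0 lower upper).
Qed.
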